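(* Let $H$ be a graph on $h$ vertices with at least one edge, let $0<\epsilon<1$, and let $\delta>0$ be such that $\delta^{-1}$ is a tower of twos of height $5h^4\log \epsilon^{-1}$. Then every graph $G$ on $n$ vertices with at most $\delta n^h$ copies of $H$ can be made $H$-free by removing at most $\epsilon n^2$ edges.
   Context: All graphs are finite and simple, and $\log$ is the natural logarithm (base $e$). A copy of $H$ in $G$ is a (not necessarily induced) subgraph of $G$ isomorphic to $H$; $G$ is $H$-free if it contains no copy of $H$. The tower of twos of height $m$ is $\mathrm{tow}(m)$, where $\mathrm{tow}(0)=1$ and $\mathrm{tow}(m+1)=2^{\mathrm{tow}(m)}$ for integers $m\ge 0$; when the height $5h^4\log\epsilon^{-1}$ is not an integer it is rounded up to the next integer. *)

(* Defs.v *)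
From HB Require Import structures.
From mathcomp Require Import all_boot all_order all_algebra.
From mathcomp Require Import reals exp.

Set Implicit Arguments.
Unset Strict Implicit.
Unset Printing Implicit Defensive.

(* A finite simple graph with vertex set all of [T]; an edge is its unordered
   pair of endpoints. *)
Record sgraph (T : finType) := SGraph {
  edges : {set {set T}};
  edges_card2 : forall e, e \in edges -> #|e| = 2
}.

Section Graphs.
Variables T U : finType.
Implicit Types (H : sgraph T) (G : sgraph U).

(* A subgraph is a pair (vertex set, edge set), so that isolated vertices of
   H are part of a copy, and copies are counted as subgraphs, not embeddings. *)
Definition is_subgraph G (S : {set U} * {set {set U}}) : bool :=
  (S.2 \subset edges G) && (S.2 \subset powerset S.1).

Definition isomorphic_to H (S : {set U} * {set {set U}}) : bool :=
  [exists f : {ffun T -> U},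
    [&& injectiveb f, f @: [set: T] == S.1
      & [forall x, forall y,
          ([set x; y] \in edges H) == ([set f x; f y] \in S.2)]]].

Definition copies H G : {set {set U} * {set {set U}}} :=
  [set S | is_subgraph G S && isomorphic_to H S].

Definition free_of H G : Prop := forall S, S \notin copies H G.

Lemma remove_edges_card2 G (F : {set {set U}}) e :
  e \in edges G :\: F -> #|e| = 2.
Proof. by rewrite inE => /andP[_ /edges_card2]. Qed.

Definition remove_edges G (F : {set {set U}}) : sgraph U :=
  SGraph (@remove_edges_card2 G F).

End Graphs.

Fixpoint tow (m : nat) : nat := if m is m'.+1 then 2 ^ tow m' else 1.

Local Open Scope ring_scope.

(* For 0 < eps < 1 the ceiling is positive, so the absolute value is only the
   cast from int to nat. *)
Definition removal_height (R : realType) (h : nat) (eps : R) : nat :=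
  `|Num.ceil (5%:R * h%:R ^+ 4 * ln eps^-1)|%N.

(* Main.v *)
Require Import Defs.
From HB Require Import structures.
From mathcomp Require Import all_boot all_order all_algebra.
From mathcomp Require Import zify ring lra.
From mathcomp Require Import reals exp.

Set Implicit Arguments.
Unset Strict Implicit.
Unset Printing Implicit Defensive.

Import Order.TTheory GRing.Theory Num.Theory.
Local Open Scope ring_scope.

(** The proof refines a partition of the vertex set until an entropy budget is
    exhausted, in the manner of Fox; no regularity lemma is involved, which is
    why the tower has height only logarithmic in [eps^-1].

    Take a largest family [K] of edge-disjoint copies of [H] in
    [G], and let [F] be the union of their edge sets.  Deleting [F] leaves no
    copy of [H], so the theorem holds unless [|F| > eps n^2].  Assume this.
    Then [F] is itself a graph in which the copies in [K] are spread out: with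
    [e] the number of edges of [H], any set of edges of [F] that meets every
    copy in [K] has at least [|K| >= |F| / e] elements.

    A finite family of vertex sets cuts the vertices into atoms.  Its entropy is
    the sum over all ordered pairs of vertices of [a ln a], where [a] is the
    density of [F] between the atoms of the two vertices.  It is at most [0], it
    never decreases when the family grows, and for the empty family it is at
    least [- 2 |F| ln eps^-1].  So it suffices to find a bounded enlargement
    that gains a fixed proportion [3/4 h^-4] of [|F|] each time, until more than
    [3 h^4 ln eps^-1] enlargements have been made ([entropy_gain],
    [packing_gain]).

    The gain comes from sparse rectangles.  If two atoms [A], [B] have density
    [a] and a union of few rectangles covers a proportion [c] of [A x B] while
    having density at most [a / 12], then adding the sides of these rectangles
    to the family gains at least [c / 2] times the number of edges between [A]
    and [B].  Such covers exist: if [H] has few homomorphisms into [F] with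
    the image of each vertex [k] prescribed to lie in [V k], then for some edge
    [(x, y)] of [H] the pair [V x], [V y] has such a cover with
    [c = 1 / (2 e)] ([few_homs_cover]).  To see this, choose for every edge of
    [H] a largest admissible union of rectangles.  If all of them covered less
    than the proportion [c], at least half of the choices of vertices would avoid
    all of them.
    Replace the condition of avoiding the cover by that of being an edge of
    [F], for one edge of [H] after the other.  The number of good choices drops
    from at least half to very few, so one replacement is responsible for a big
    drop.  Fixing all vertices except the two ends of the edge replaced turns
    this drop into a new sparse rectangle, against maximality.

    Since [G] has few copies of [H], this applies to the atoms met by every copy
    in [K], except for the copies with an edge between atoms of low density or
    at a vertex in a small atom.  Hence a fixed proportion of the copies have an
    edge between two atoms with a good cover.  One enlargement makes the family
    at most exponentially larger, which costs one level of the tower; the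
    [2 h^4 ln eps^-1] levels that are left over absorb the dependence of the
    parameters on [h] and [eps] ([height_parameters], [tower_step],
    [few_homs_arith]). *)


(** * Conditional averages and entropy *)

Section ConditionalAverage.
Variables (R : realFieldType) (X : finType) (L : eqType).
Implicit Types (pi : X -> L) (f g : X -> R).

Definition cell pi x : {set X} := [set y | pi y == pi x].

Definition cavg pi g x : R := (\sum_(y in cell pi x) g y) / #|cell pi x|%:R.

Lemma card_cell_gt0 pi x : 0 < #|cell pi x|%:R :> R.
Proof. by rewrite ltr0n; apply/card_gt0P; exists x; rewrite inE. Qed.

Lemma eq_cell pi x y : pi x = pi y -> cell pi x = cell pi y.
Proof. by move=> pixy; apply/setP=> z; rewrite !inE pixy. Qed.

Lemma cavg_const pi g x y : pi x = pi y -> cavg pi g x = cavg pi g y.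
Proof. by move=> pixy; rewrite /cavg (eq_cell pixy). Qed.

Lemma cavg_ge0 pi g x : (forall y, 0 <= g y) -> 0 <= cavg pi g x.
Proof.
by move=> g_ge0; rewrite divr_ge0 ?ler0n //; apply: sumr_ge0 => y _.
Qed.

(** Conditional expectation is self-adjoint; a weight that is constant on cells
    does not see the difference between a function and its average. *)
Lemma sum_mul_cavg pi f g : (forall x y, pi x = pi y -> f x = f y) ->
  \sum_x f x * cavg pi g x = \sum_x f x * g x.
Proof.
move=> f_const.
transitivity (\sum_x \sum_(y in cell pi x) f y * g y / #|cell pi y|%:R).
  apply: eq_bigr => x _; rewrite /cavg mulrA mulr_sumr mulr_suml.
  apply: eq_bigr => y; rewrite inE => /eqP pixy.
  by rewrite (f_const _ _ pixy) (eq_cell pixy).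
rewrite (exchange_big_dep predT) //=; apply: eq_bigr => y _.
rewrite (eq_bigl (mem (cell pi y))); last by move=> x; rewrite !inE eq_sym.
by rewrite sumr_const -[LHS]mulr_natr divfK // gt_eqF ?card_cell_gt0.
Qed.

Lemma sum_cavg pi g : \sum_x cavg pi g x = \sum_x g x.
Proof.
have := @sum_mul_cavg pi (fun=> 1) g (fun _ _ _ => erefl).
by under eq_bigr do rewrite mul1r; under [in RHS]eq_bigr do rewrite mul1r.
Qed.

Lemma cavg_refined_eq0 pi (pi' : X -> L) g x :
    (forall y z, pi' y = pi' z -> pi y = pi z) -> (forall y, 0 <= g y) ->
  cavg pi g x = 0 -> cavg pi' g x = 0.
Proof.
move=> fine g_ge0 /eqP.
rewrite mulf_eq0 invr_eq0 [X in _ || X]gt_eqF ?card_cell_gt0 // orbF.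
rewrite psumr_eq0 // => /allP g0.
rewrite /cavg big1 ?mul0r // => y; rewrite inE => /eqP /fine pixy.
by apply/eqP/(implyP (g0 y (mem_index_enum y))); rewrite inE pixy.
Qed.

End ConditionalAverage.

Lemma sum_sparse_cells (R : realFieldType) (X : finType) (L : eqType)
    (pi : X -> L) (g : X -> R) (t : R) : 0 <= t ->
  \sum_(x | cavg pi g x < t) g x <= t * #|X|%:R.
Proof.
move=> t_ge0; pose ind x : R := (cavg pi g x < t)%R%:R.
have ind_sum (f : X -> R) : \sum_(x | cavg pi g x < t) f x = \sum_x ind x * f x.
  rewrite big_mkcond; apply: eq_bigr => x _; rewrite /ind.
  by case: (_ < t); rewrite ?mul1r ?mul0r.
rewrite ind_sum -(sum_mul_cavg (pi := pi)); last first.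
  by move=> x y pixy; rewrite /ind (cavg_const g pixy).
rewrite -ind_sum mulr_natr -sumr_const big_mkcond [leRHS]big_mkcond /=.
by apply: ler_sum => x _; case: ifP => // /ltW.
Qed.

Section Entropy.
Variables (R : realType) (X : finType) (L : eqType).

Definition entropy (pi : X -> L) (g : X -> R) : R :=
  \sum_x cavg pi g x * ln (cavg pi g x).

Lemma ln_le_sub1 (t : R) : 0 < t -> ln t <= t - 1.
Proof.
by move=> t_gt0; rewrite -{1}(subrKC 1 t) le_ln1Dx // ltrBrDr addNr.
Qed.

(** Convexity of [t ln t]: the graph lies above the tangent at [a]. The
    hypothesis lets [a = 0] through, where there is no tangent. *)
Lemma xlnx_tangent (a b : R) : 0 <= a -> 0 <= b -> (a = 0 -> b = 0) ->
  a * ln a + (ln a + 1) * (b - a) <= b * ln b.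
Proof.
move=> a_ge0 b_ge0 ab0; have [a0|a_neq0] := eqVneq a 0.
  by rewrite (ab0 a0) a0 !(mul0r, mulr0, subrr, addr0).
have a_gt0 : 0 < a by rewrite lt_def a_neq0.
have [->|b_neq0] := eqVneq b 0; first by rewrite (ln0 (lexx 0)); lra.
have b_gt0 : 0 < b by rewrite lt_def b_neq0.
have: b * ln (a / b) <= b * (a / b - 1).
  by rewrite ler_pM2l ?ln_le_sub1 ?divr_gt0.
rewrite ln_div ?posrE // !mulrBr mulrCA divff // !mulr1; lra.
Qed.

(** The quantitative form of convexity on which every gain of entropy rests.
    The vertical gap between [t ln t] and its tangent at [a] is
    [b ln (b / a) - b + a]. As a function of [b] it is convex, so it lies above
    its own tangent at [b = a / 4], which is [3/4 a - (ln 4) b]. A linear bound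
    in [b] is what allows averaging over sets that are sparse only on average. *)
Lemma xlnx_defect (a b : R) : 0 <= a -> 0 <= b -> (a = 0 -> b = 0) ->
  a * ln a + (ln a + 1) * (b - a) + (3 / 4 * a - 3 * b) <= b * ln b.
Proof.
move=> a_ge0 b_ge0 ab0; have [a0|a_neq0] := eqVneq a 0.
  by rewrite (ab0 a0) a0 !(mul0r, mulr0, subrr, addr0).
have a_gt0 : 0 < a by rewrite lt_def a_neq0.
have [->|b_neq0] := eqVneq b 0; first by rewrite (ln0 (lexx 0)); lra.
have b_gt0 : 0 < b by rewrite lt_def b_neq0.
have b4_gt0 : 0 < 4 * b by lra.
have: b * ln (a / (4 * b)) <= b * (a / (4 * b) - 1).
  by rewrite ler_pM2l ?ln_le_sub1 ?divr_gt0.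
have -> : b * (a / (4 * b) - 1) = a / 4 - b by field.
rewrite ln_div ?lnM ?posrE //.
have: b * ln (4 : R) <= b * (4 - 1) by rewrite ler_pM2l ?ln_le_sub1.
rewrite !mulrBr !mulrDr; lra.
Qed.

(** Summing the tangent bounds over all points, the linear terms cancel because
    their slope [ln a + 1] is constant on the coarse cells. On a set [C] that
    is a union of fine cells the fine average may be replaced by [g] itself. *)
Lemma entropy_defect (pi pi' : X -> L) (g : X -> R) (C : {set X}) :
    (forall x y, pi' x = pi' y -> pi x = pi y) -> (forall x, 0 <= g x) ->
    (forall x y, pi' x = pi' y -> (x \in C) = (y \in C)) ->
  entropy pi g + \sum_(x in C) (3 / 4 * cavg pi g x - 3 * g x)
    <= entropy pi' g.
Proof.
move=> fine g_ge0 Cfine.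
pose a := cavg pi g; pose b := cavg pi' g.
have sumC : \sum_(x in C) (3 / 4 * a x - 3 * g x)
          = \sum_(x in C) (3 / 4 * a x - 3 * b x).
  rewrite !sumrB; congr (_ - _); rewrite !(big_mkcond (mem C)) /=.
  have := @sum_mul_cavg R X L pi' (fun x => if x \in C then 3 else 0) g.
  move=> E; transitivity (\sum_x (if x \in C then 3 else 0) * g x).
    by apply: eq_bigr => x _; case: ifP; rewrite ?mul0r.
  rewrite -E; last by move=> x y /Cfine ->.
  by apply: eq_bigr => x _; case: ifP; rewrite ?mul0r.
have sum0 : \sum_x (ln (a x) + 1) * (b x - a x) = 0.
  under eq_bigr do rewrite mulrBr.
  rewrite sumrB !sum_mul_cavg ?subrr // => x y.
  - by move=> /(cavg_const g); rewrite /a => ->.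
  - by move=> /fine/(cavg_const g); rewrite /a => ->.
have -> : entropy pi g =
    \sum_x (a x * ln (a x) + (ln (a x) + 1) * (b x - a x)).
  by rewrite big_split /= sum0 addr0.
rewrite sumC (big_mkcond (mem C)) -big_split /=; apply: ler_sum => x _.
have a_ge0 : 0 <= a x by apply: cavg_ge0.
have b_ge0 : 0 <= b x by apply: cavg_ge0.
have ab0 : a x = 0 -> b x = 0 by apply: cavg_refined_eq0.
case: ifP => _; first exact: xlnx_defect.
by rewrite addr0; apply: xlnx_tangent.
Qed.

Lemma entropy_le0 (pi : X -> L) (g : X -> R) :
  (forall x, 0 <= g x <= 1) -> entropy pi g <= 0.
Proof.
move=> g01; apply: sumr_le0 => x _.
have g_ge0 y : 0 <= g y by case/andP: (g01 y).
apply: mulr_ge0_le0; first exact: cavg_ge0.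
apply: ln_le0; rewrite ler_pdivrMr ?card_cell_gt0 // mul1r -sum1_card natr_sum.
by apply: ler_sum => y _; case/andP: (g01 y).
Qed.

(** If in each coarse cell inside [Sh] the set [C] has proportion at least [c]
    and density at most a twelfth of the density [a] of the cell, the defect is
    at least [(3/4 - 3/12) a = a / 2] per point of [C]. *)
Lemma entropy_gain (pi pi' : X -> L) (g : X -> R) (C Sh : {set X}) (c : R) :
    (forall x y, pi' x = pi' y -> pi x = pi y) -> (forall x, 0 <= g x) ->
    (forall x y, pi' x = pi' y -> (x \in C) = (y \in C)) ->
    (forall x y, pi x = pi y -> (x \in Sh) = (y \in Sh)) ->
    C \subset Sh ->
    (forall x, x \in Sh -> c * #|cell pi x|%:R <= #|C :&: cell pi x|%:R) ->
    (forall x, x \in Sh -> \sum_(y in C :&: cell pi x) g y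
                        <= cavg pi g x / 12 * #|C :&: cell pi x|%:R) ->
  entropy pi g + c / 2 * \sum_(x in Sh) g x <= entropy pi' g.
Proof.
move=> fine g_ge0 Cfine Shcell CSh Clarge Csparse.
apply: le_trans (entropy_defect fine g_ge0 Cfine); rewrite lerD2l.
pose a := cavg pi g.
pose F x := if x \in C then 3 / 4 * a x - 3 * g x else 0.
have -> : \sum_(x in Sh) g x = \sum_(x in Sh) a x.
  rewrite !(big_mkcond (mem Sh)) /=.
  have := @sum_mul_cavg R X L pi (fun x => (x \in Sh)%:R) g.
  move=> E; transitivity (\sum_x (x \in Sh)%:R * g x).
    by apply: eq_bigr => x _; case: ifP; rewrite ?mul0r ?mul1r.
  rewrite -E; last by move=> x y /Shcell ->.
  by apply: eq_bigr => x _; case: ifP; rewrite ?mul0r ?mul1r.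
rewrite [leRHS]big_mkcond -/(\sum_x F x) /= -(sum_cavg pi F).
rewrite mulr_sumr big_mkcond; apply: ler_sum => x _.
have card_gt0 := card_cell_gt0 R pi x.
have sumF : \sum_(y in cell pi x) F y =
    3 / 4 * a x * #|C :&: cell pi x|%:R - 3 * \sum_(y in C :&: cell pi x) g y.
  rewrite mulr_sumr mulr_natr -sumr_const -sumrB [LHS]big_mkcond [RHS]big_mkcond /=.
  apply: eq_bigr => y _; rewrite !inE /F andbC; case: eqP => //= pixy.
  by case: ifP => // _; rewrite /a (cavg_const g pixy).
rewrite /cavg sumF; case: ifP => xSh; last first.
  have -> : C :&: cell pi x = set0.
    apply/setP=> y; rewrite !inE; apply/andP=> -[/(subsetP CSh) ySh /eqP pixy].
    by rewrite (Shcell _ _ pixy) xSh in ySh.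
  by rewrite cards0 big_set0 !mulr0 subrr mul0r.
rewrite ler_pdivlMr //.
have := Clarge _ xSh; have := Csparse _ xSh.
have: 0 <= a x by apply: cavg_ge0.
rewrite -/(a x).
move: (\sum_(y in _) g y) (a x) (#|C :&: _|%:R) (#|cell pi x|%:R) => s t m k.
move=> t_ge0 sle mle; have := ler_wpM2l t_ge0 mle; lra.
Qed.

Lemma entropy_trivial (pi : X -> L) (g : X -> R) : (forall x y, pi x = pi y) ->
  entropy pi g = (\sum_x g x) * ln ((\sum_x g x) / #|X|%:R).
Proof.
move=> pi_const.
have avg x : cavg pi g x = (\sum_x g x) / #|X|%:R.
  have cellT : cell pi x = [set: X] by apply/setP=> y; rewrite !inE (pi_const y x) eqxx.
  by rewrite /cavg cellT cardsT; congr (_ / _); apply: eq_bigl => y; rewrite inE.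
rewrite -[X in _ = X * _](sum_cavg pi) mulr_suml /entropy.
by apply: eq_bigr => x _; rewrite avg.
Qed.

End Entropy.

(** * Random choices and resampling of coordinates *)

Section Resampling.
Variables (T U : finType).
Implicit Types (v : {ffun T -> U}) (V : T -> {set U}).

Definition update v x a : {ffun T -> U} := [ffun k => if k == x then a else v k].

Definition choices V : {set {ffun T -> U}} :=
  [set v : {ffun T -> U} | [forall k, v k \in V k]].

Lemma choicesP V v : reflect (forall k, v k \in V k) (v \in choices V).
Proof. by rewrite inE; apply: forallP. Qed.

Lemma update_choices V v x a :
  v \in choices V -> a \in V x -> update v x a \in choices V.
Proof.
move=> /choicesP vV aV; apply/choicesP=> k; rewrite ffunE.
by case: eqP => [->|].
Qed.

Lemma card_choices V : #|choices V| = (\prod_k #|V k|)%N.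
Proof.
transitivity #|(family (fun k => mem (V k)) : pred {ffun T -> U})|.
  by apply: eq_card => v; rewrite inE; apply/forallP/familyP.
by rewrite card_family foldrE big_map big_enum.
Qed.

(** Replacing one coordinate of a uniformly random choice by an independent
    value gives a uniformly random choice. The involution that exchanges the
    old and the new value witnesses this. *)
Lemma resample (R : nmodType) V x (F : {ffun T -> U} -> R) :
  \sum_(v in choices V) \sum_(a in V x) F (update v x a)
    = \sum_(v in choices V) F v *+ #|V x|.
Proof.
under [RHS]eq_bigr do rewrite -sumr_const.
rewrite !pair_big /=.
pose swap (q : {ffun T -> U} * U) := (update q.1 x q.2, q.1 x).
have swapK : involutive swap.
  move=> [v a]; rewrite /swap /= !ffunE eqxx; congr (_, _).
  by apply/ffunP=> k; rewrite !ffunE; case: eqP => // ->.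
rewrite [RHS](reindex_inj (inv_inj swapK)) /=; apply: eq_bigl => -[v a] /=.
apply/andP/andP=> -[vV aV]; first by rewrite update_choices ?(choicesP _ _ vV).
split; last by move/choicesP/(_ x): vV; rewrite ffunE eqxx.
apply/choicesP=> k; move/choicesP/(_ k): vV; rewrite ffunE.
by case: eqP => // ->.
Qed.

Lemma resample2 (R : nmodType) V x y (F : {ffun T -> U} -> R) :
  \sum_(v in choices V) \sum_(a in V x) \sum_(b in V y)
      F (update (update v x a) y b)
    = (\sum_(v in choices V) F v) *+ (#|V x| * #|V y|).
Proof.
rewrite (resample V x (fun w => \sum_(b in V y) F (update w y b))).
by rewrite sumrMnl resample sumrMnl mulnC mulrnA.
Qed.

End Resampling.

Lemma exists_ge_mean (R : realFieldType) (I : finType) (D : {set I})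
    (f : I -> R) (M : R) :
  D != set0 -> M <= \sum_(i in D) f i -> exists2 i, i \in D & M <= #|D|%:R * f i.
Proof.
case/set0Pn => i0 Di0 le_M.
case: (pickP [pred i in D | M <= #|D|%:R * f i]) => [i /andP[]|none]; first by exists i.
have: \sum_(i in D) #|D|%:R * f i < \sum_(i in D) M.
  apply: ltr_sum => [|i Di]; first by apply/hasP; exists i0; rewrite ?mem_index_enum.
  by have := none i; rewrite /= Di ltNge /= => ->.
rewrite -mulr_sumr sumr_const -[ltRHS]mulr_natl ltr_pM2l ?(le_gtF le_M) //.
by rewrite ltr0n card_gt0; apply/set0Pn; exists i0.
Qed.

(** * Unions of sparse rectangles *)

Section Covers.
Variables (R : realFieldType) (U : finType) (G : {set U * U}) (beta gamma : R).
Implicit Types (A B : {set U}) (L : {set {set U} * {set U}}).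

Definition covered L : {set U * U} := \bigcup_(r in L) setX r.1 r.2.

(** The last condition bounds the number of rectangles: on average each of them
    has to account for a proportion [gamma] of the rectangle [A x B]. *)
Definition sparse_cover A B L : bool :=
  [&& covered L \subset setX A B,
      #|G :&: covered L|%:R <= beta * #|covered L|%:R
    & gamma * #|setX A B|%:R * #|L|%:R <= #|covered L|%:R].

Definition best_cover A B : {set {set U} * {set U}} :=
  [arg max_(L > set0 | sparse_cover A B L) #|covered L|]%N.

Lemma covered0 : covered set0 = set0.
Proof. by rewrite /covered big_set0. Qed.

Lemma best_coverP A B : sparse_cover A B (best_cover A B) /\
  forall L, sparse_cover A B L -> (#|covered L| <= #|covered (best_cover A B)|)%N.
Proof.
rewrite /best_cover; case: arg_maxnP => [|L //].
by rewrite /sparse_cover covered0 setI0 !cards0 sub0set !mulr0 lexx.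
Qed.

Lemma best_cover_sub A B : covered (best_cover A B) \subset setX A B.
Proof. by have [/and3P[]] := best_coverP A B. Qed.

Lemma best_cover_sparse A B :
  #|G :&: covered (best_cover A B)|%:R <= beta * #|covered (best_cover A B)|%:R.
Proof. by have [/and3P[]] := best_coverP A B. Qed.

Lemma card_best_cover A B : 0 < gamma ->
  A != set0 -> B != set0 -> #|best_cover A B|%:R <= gamma^-1.
Proof.
move=> gamma_gt0 A0 B0; have [/and3P[sub _ le_cov] _] := best_coverP A B.
have AB_gt0 : 0 < #|setX A B|%:R :> R.
  by rewrite cardsX ltr0n muln_gt0 !card_gt0 A0.
rewrite -(ler_pM2l (mulr_gt0 gamma_gt0 AB_gt0)); apply: le_trans le_cov _.
by rewrite mulrAC divff ?gt_eqF // mul1r ler_nat subset_leq_card.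
Qed.

(** A rectangle whose part outside the best cover is both large and sparsely
    filled, even counting the edges already covered, could be added to it. *)
Lemma best_cover_maximal A B A' B' : A' \subset A -> B' \subset B ->
  let new := setX A' B' :\: covered (best_cover A B) in
  0 <= beta -> (0 < #|new|)%N -> gamma * #|setX A B|%:R <= #|new|%:R ->
  #|G :&: setX A' B'|%:R <= beta * #|new|%:R -> 0 <= gamma -> False.
Proof.
move=> sA sB; set L := best_cover A B => new beta_ge0 new_gt0 new_large Gsparse.
move=> gamma_ge0.
have [/and3P[sub sparse le_cov] Lmax] := best_coverP A B.
rewrite -/L in sub sparse le_cov Lmax.
have covE : covered ((A', B') |: L) = covered L :|: new.
  rewrite /covered bigcup_setU big_set1 -/(covered L) /=.
  by apply/setP=> z; rewrite /new !inE; case: (z \in covered L); rewrite ?orbT ?orbF.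
have dis : [disjoint covered L & new] by rewrite -setI_eq0 /new setDE setICA setICr setI0.
have card_cov : #|covered ((A', B') |: L)| = (#|covered L| + #|new|)%N.
  by rewrite covE cardsU (disjoint_setI0 dis) cards0 subn0.
suff /Lmax : sparse_cover A B ((A', B') |: L)
  by rewrite card_cov leqNgt -[X in (X < _)%N]addn0 ltn_add2l new_gt0.
apply/and3P; split.
- rewrite covE subUset sub /new; apply: subset_trans (subsetDl _ _) _.
  by rewrite setXS.
- rewrite card_cov natrD mulrDr covE setIUr.
  have leG : (#|(G :&: covered L) :|: (G :&: new)| <=
          #|G :&: covered L| + #|G :&: setX A' B'|)%N.
    rewrite cardsU leq_subLR addnCA leq_add2l.
    apply: leq_trans (leq_addl _ _); apply: subset_leq_card.
    by rewrite setIS // subsetDl.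
  apply: (@le_trans _ _ (#|G :&: covered L| + #|G :&: setX A' B'|)%:R).
    by rewrite ler_nat.
  by rewrite natrD lerD.
- rewrite card_cov natrD; apply: le_trans (_ : _ <=
      gamma * #|setX A B|%:R * (#|L|%:R + 1)) _.
    rewrite ler_wpM2l ?mulr_ge0 ?ler0n // natr1 ler_nat cardsU1.
    by case: (_ \in _).
  by rewrite mulrDr mulr1 lerD.
Qed.

End Covers.

(** * Few homomorphisms force a large sparse cover *)

Section Hybrid.
Variables (R : realFieldType) (T U : finType) (V : T -> {set U}).
Variable es : seq (T * T).
Hypothesis es_uniq : uniq es.
Hypothesis es_loopless : forall p, p \in es -> p.1 != p.2.
Hypothesis es_simple : forall p q, p \in es -> q \in es ->
  p.1 \in [:: q.1; q.2] -> p.2 \in [:: q.1; q.2] -> q = p.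
Hypothesis V_neq0 : forall k, V k != set0.
Implicit Types (S : T * T -> {set U * U}) (G : {set U * U}).

(** The maps with [v k] in [V k] that send each edge [p] of [H] to a pair in
    [S p]. Letting [S] depend on [p] allows hybrids in which some edges of [H]
    are asked to be edges of [G] and the others only to avoid a cover. *)
Definition homs S : {set {ffun T -> U}} :=
  [set v in choices V | all (fun p => (v p.1, v p.2) \in S p) es].

Lemma choices_neq0 : choices V != set0.
Proof.
rewrite -card_gt0 card_choices prodn_gt0 // => k.
by rewrite card_gt0.
Qed.

Definition replace S p G q := if q == p then G else S q.

(** Fix the values of a map away from the ends [x], [y] of [p]. The conditions
    on the other edges of [H] then restrict the values at [x] to a set [A] and
    those at [y] to a set [B] independently, as no other edge contains both
    ends. So the admissible values form a rectangle, and averaging over the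
    fixed values finds one in which the drop is as large as it is overall. *)
Lemma exchange_edge S p G (alpha : R) : p \in es -> 0 < alpha ->
    #|homs (replace S p G)|%:R <= alpha * #|homs S|%:R ->
  exists A B : {set U}, [/\ A \subset V p.1, B \subset V p.2 &
    #|homs S|%:R * (#|V p.1| * #|V p.2|)%:R <= 2 * #|choices V|%:R *
      (#|S p :&: setX A B|%:R - #|G :&: setX A B|%:R / (2 * alpha))].
Proof.
move=> es_p alpha_gt0 few; pose x := p.1; pose y := p.2.
have xy : x != y := es_loopless es_p.
pose rest v q := (q != p) ==> ((v q.1, v q.2) \in S q).
pose w (a b : U) : R :=
  ((a, b) \in S p)%:R - ((a, b) \in G)%:R / (2 * alpha).
(* [F] counts the hybrids before the replacement, minus those after it with a
   weight that makes the latter worth at most half of the former. *)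
pose F (v : {ffun T -> U}) := (all (rest v) es)%:R * w (v x) (v y).
have sumF : \sum_(v in choices V) F v =
    #|homs S|%:R - #|homs (replace S p G)|%:R / (2 * alpha).
  have split_all (S' : T * T -> {set U * U}) (v : {ffun T -> U}) :
      (forall q, q != p -> S' q = S q) ->
      all (fun q => (v q.1, v q.2) \in S' q) es =
      all (rest v) es && ((v x, v y) \in S' p).
    move=> S'S; apply/allP/andP => [allS|[/allP allr vp] q es_q].
      split; last exact: allS.
      by apply/allP=> q es_q; apply/implyP=> /S'S <-; apply: allS.
    have [->//|qp] := eqVneq q p; rewrite S'S //.
    by have := allr q es_q; rewrite /rest qp.
  have card_homs S' : (forall q, q != p -> S' q = S q) -> #|homs S'|%:R =
      \sum_(v in choices V) (all (rest v) es)%:R * ((v x, v y) \in S' p)%:R :> R.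
    move=> S'S; rewrite -sum1_card natr_sum big_mkcond [RHS]big_mkcond /=.
    apply: eq_bigr => v _; rewrite inE (split_all _ _ S'S).
    by case: (v \in _); case: (all _ _); case: (_ \in S' p); rewrite /= ?mulr1 ?mulr0.
  rewrite !card_homs // => [|q]; last by rewrite /replace => /negPf->.
  rewrite mulr_suml -sumrB; apply: eq_bigr => v _.
  by rewrite /F /w /replace eqxx mulrBr mulrA.
have := resample2 V x y F.
have le_sum : #|homs S|%:R / 2 <= \sum_(v in choices V) F v.
  rewrite sumF; set t := _ / (2 * alpha); have: t <= #|homs S|%:R / 2.
    rewrite /t ler_pdivrMr ?mulr_gt0 //; apply: le_trans few _.
    by rewrite le_eqVlt; apply/orP; left; apply/eqP; field.
  lra.
move=> sumE.
have: #|homs S|%:R / 2 * (#|V x| * #|V y|)%:R <= \sum_(v in choices V)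
    \sum_(a in V x) \sum_(b in V y) F (update (update v x a) y b).
  by rewrite sumE -[leRHS]mulr_natr ler_wpM2r.
case/(exists_ge_mean choices_neq0) => v /choicesP vV large.
(* An edge at [y] is a condition on [B] only, and one at [x] on [A] only; the
   edges away from both are imposed on both sides. *)
pose A := [set a in V x | all (fun q => (y \in [:: q.1; q.2]) ||
                                       rest (update v x a) q) es].
pose B := [set b in V y | all (fun q => (x \in [:: q.1; q.2]) ||
                                       rest (update v y b) q) es].
have restE a b : all (rest (update (update v x a) y b)) es =
    all (fun q => (y \in [:: q.1; q.2]) || rest (update v x a) q) es &&
    all (fun q => (x \in [:: q.1; q.2]) || rest (update v y b) q) es.
  rewrite -all_predI; apply: eq_in_all => q es_q.
  rewrite /rest /=; have [//|qp /=] := eqVneq q p; first by rewrite !orbT.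
  have : ~~ ((x \in [:: q.1; q.2]) && (y \in [:: q.1; q.2])).
    by apply: contra qp => /andP[xq yq]; rewrite (es_simple es_p es_q xq yq).
  rewrite !inE !ffunE !(eq_sym x) !(eq_sym y).
  case: (eqVneq q.1 x) => [->|q1x]; rewrite ?(negPf xy).
    by case: (eqVneq q.2 y) => // _ _; rewrite andbT.
  case: (eqVneq q.2 x) => [->|q2x]; rewrite ?(negPf xy).
    by case: (eqVneq q.1 y) => // _ _; rewrite andbT.
  case: (eqVneq q.1 y) => //= q1y _; case: (eqVneq q.2 y) => //= q2y.
  by rewrite andbb.
exists A, B; split; try by apply/subsetP=> z; rewrite inE => /andP[].
suff <- : \sum_(a in V x) \sum_(b in V y) F (update (update v x a) y b) =
   #|S p :&: setX A B|%:R - #|G :&: setX A B|%:R / (2 * alpha).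
  by move: large; rewrite -/x -/y; lra.
have card_rect (C : {set U * U}) : #|C :&: setX A B|%:R =
    \sum_(a in V x) \sum_(b in V y)
      (all (rest (update (update v x a) y b)) es && ((a, b) \in C))%:R :> R.
  rewrite -sum1_card natr_sum pair_big big_mkcond [RHS]big_mkcond /=.
  apply: eq_bigr => -[a b] _; rewrite restE !inE /=.
  case: (a \in V x); case: (b \in V y); case: ((a, b) \in C);
    by do 2 case: (all _ _).
rewrite !card_rect mulr_suml -sumrB; apply: eq_bigr => a _.
rewrite mulr_suml -sumrB; apply: eq_bigr => b _.
rewrite /F !ffunE !eqxx (negPf xy) /w.
by case: (all _ _) => /=; rewrite ?mul1r ?mul0r ?subr0.
Qed.

(** Replacing the edges one at a time, each round keeps a proportion of at least
    [alpha] of the maps, or else a large sparse rectangle shows up. *)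
Lemma homs_after_exchange (E : T * T -> {set U * U}) G (alpha : R) :
    0 < alpha <= 1 -> #|choices V|%:R <= 2 * #|homs E|%:R :> R ->
    (forall p (A B : {set U}), p \in es -> A \subset V p.1 -> B \subset V p.2 ->
       alpha ^+ size es / 4 * (#|V p.1| * #|V p.2|)%:R <= #|E p :&: setX A B|%:R ->
       #|G :&: setX A B|%:R <= 2 * alpha * #|E p :&: setX A B|%:R -> False) ->
  alpha ^+ size es / 2 * #|choices V|%:R <= #|homs (fun=> G)|%:R.
Proof.
case/andP=> alpha_gt0 alpha_le1 many no_sparse.
pose S (ds : seq (T * T)) q := if q \in ds then G else E q.
have step (ds : seq (T * T)) : uniq ds -> {subset ds <= es} ->
    alpha ^+ size ds * #|homs E|%:R <= #|homs (S ds)|%:R.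
  elim: ds => [|p ds IHds] /=; first by rewrite mul1r.
  case/andP=> ds'p uniq_ds sub_es.
  have {}IHds : alpha ^+ size ds * #|homs E|%:R <= #|homs (S ds)|%:R.
    by apply: IHds => // q ds_q; apply: sub_es; rewrite inE ds_q orbT.
  have es_p : p \in es by apply: sub_es; rewrite mem_head.
  have SE : homs (S (p :: ds)) = homs (replace (S ds) p G).
    apply/setP=> v; rewrite !inE; congr (_ && _); apply: eq_all => q.
    by rewrite /S /replace inE; case: eqP.
  have Sp : S ds p = E p by rewrite /S (negPf ds'p).
  rewrite SE leNgt; apply/negP=> few.
  have few' : #|homs (replace (S ds) p G)|%:R <= alpha * #|homs (S ds)|%:R.
    apply: le_trans (ltW few) _; rewrite exprS -mulrA.
    by rewrite ler_pM2l.
  have [A [B [sA sB]]] := exchange_edge es_p alpha_gt0 few'.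
  rewrite Sp; set e := #|E p :&: _|%:R; set g := #|G :&: _|%:R.
  set c := #|choices V|%:R; set vv := (_ * _)%:R => large.
  have c_gt0 : 0 < c by rewrite ltr0n card_gt0 choices_neq0.
  have vv_ge0 : 0 <= vv by rewrite ler0n.
  have le_size : alpha ^+ size es <= alpha ^+ size ds.
    apply: (ler_wiXn2l (ltW alpha_gt0) alpha_le1).
    apply: uniq_leq_size => // q ds_q.
    by apply: sub_es; rewrite inE ds_q orbT.
  have homs_ge : alpha ^+ size es / 2 * c <= #|homs (S ds)|%:R.
    apply: le_trans IHds; rewrite -mulrA.
    apply: le_trans (_ : _ <= alpha ^+ size ds * (2^-1 * c)) _.
      by rewrite ler_wpM2r // mulr_ge0 ?invr_ge0 // ltW.
    by rewrite ler_wpM2l ?exprn_ge0 ?(ltW alpha_gt0) // ler_pdivrMl.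
  have key : alpha ^+ size es / 4 * vv <= e - g / (2 * alpha).
    rewrite -(ler_pM2l (mulr_gt0 (ltr0Sn R 1) c_gt0)).
    apply: le_trans large; apply: le_trans (_ : _ <= alpha ^+ size es / 2 * c * vv) _.
      by rewrite le_eqVlt; apply/orP; left; apply/eqP; field.
    by rewrite ler_wpM2r.
  have g_ge0 : 0 <= g / (2 * alpha).
    by rewrite divr_ge0 ?ler0n // mulr_ge0 // ltW.
  have l_ge0 : 0 <= alpha ^+ size es / 4 * vv.
    by rewrite mulr_ge0 // divr_ge0 ?exprn_ge0 // ltW.
  apply: (no_sparse p A B) => //; rewrite -/vv -/e -/g; first by lra.
  rewrite mulrC -ler_pdivrMr ?mulr_gt0 //; lra.
have -> : homs (fun=> G) = homs (S es).
  apply/setP=> v; rewrite !inE; congr (_ && _); apply: eq_in_all => q es_q.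
  by rewrite /S es_q.
apply: le_trans (step es es_uniq (fun q => id)).
rewrite -mulrA ler_wpM2l ?exprn_ge0 ?(ltW alpha_gt0) //.
by rewrite ler_pdivrMl.
Qed.


(** For a random choice the pair of values at [x] and [y] is uniform. *)
Lemma count_pair_in x y (C : {set U * U}) : x != y -> C \subset setX (V x) (V y) ->
  (#|[set v in choices V | (v x, v y) \in C]| * (#|V x| * #|V y|)
     = #|choices V| * #|C|)%N.
Proof.
move=> xy sC.
have := resample2 V x y (fun v => ((v x, v y) \in C) : nat).
have mulrnE (a b : nat) : a *+ b = (a * b)%N by rewrite -mulr_natr natn.
rewrite mulrnE => E.
transitivity (\sum_(v in choices V) \sum_(a in V x) \sum_(b in V y)
   ((a, b) \in C : nat))%N.
  transitivity ((\sum_(v in choices V) ((v x, v y) \in C : nat)) * (#|V x| * #|V y|))%N.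
    congr (_ * _)%N; rewrite -sum1_card big_mkcond [RHS]big_mkcond /=.
    by apply: eq_bigr => v _; rewrite inE; case: (v \in _); case: (_ \in C).
  rewrite -E; apply: eq_bigr => v _; apply: eq_bigr => a _; apply: eq_bigr => b _.
  by rewrite !ffunE !eqxx (negPf xy).
rewrite sum_nat_const; congr (_ * _)%N.
rewrite pair_big -sum1_card [LHS]big_mkcond [RHS]big_mkcond; apply: eq_bigr => -[a b] _ /=.
case abC: ((a, b) \in C); last by case: ifP.
by have := subsetP sC _ abC; rewrite !inE /= => ->.
Qed.

(** If every edge of [H] had a best cover of proportion below [1 / (2 e)], at
    least half of all choices would avoid the covers, by the union bound. The
    hybrid argument would then give many homomorphisms. *)
Lemma few_homs_cover G (beta : R) : (0 < size es)%N -> 0 < beta <= 2 ->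
    #|homs (fun=> G)|%:R < (beta / 2) ^+ size es / 2 * #|choices V|%:R ->
  exists2 p, p \in es &
    (#|V p.1| * #|V p.2| <=
     2 * size es * #|covered (best_cover G beta ((beta / 2) ^+ size es / 4)
                                 (V p.1) (V p.2))|)%N.
Proof.
move=> es_gt0 /andP[beta_gt0 beta_le2]; set gamma := _ / 4.
pose cov (p : T * T) := covered (best_cover G beta gamma (V p.1) (V p.2)).
have gamma_gt0 : 0 < gamma by rewrite divr_gt0 ?exprn_gt0 ?divr_gt0.
have [/hasP[p es_p large]|/hasPn small] :=
  boolP (has (fun p => #|V p.1| * #|V p.2| <= 2 * size es * #|cov p|)%N es).
  by exists p.
have V_gt0 k : (0 < #|V k|)%N by rewrite card_gt0.
have many : (#|choices V| <= 2 * #|homs (fun p => ~: cov p)|)%N.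
  pose bad p := [set v in choices V | (v p.1, v p.2) \in cov p].
  have cover_choices : choices V \subset
      homs (fun p => ~: cov p) :|: \bigcup_(p <- es) bad p.
    apply/subsetP=> v Vv; rewrite inE orbC; apply/orP.
    have [/allP ok|/allPn[p es_p vp]] :=
      boolP (all (fun p => (v p.1, v p.2) \in ~: cov p) es).
      by right; rewrite inE Vv; apply/allP.
    left; rewrite (big_rem p) //= in_setU; apply/orP; left.
    by move: vp; rewrite in_setC negbK /bad in_set Vv.
  have bad_small p : p \in es -> (2 * size es * #|bad p| <= #|choices V|)%N.
    move=> es_p; have VV_gt0 : (0 < #|V p.1| * #|V p.2|)%N by rewrite muln_gt0 !V_gt0.
    rewrite -(leq_pmul2r VV_gt0) -mulnA count_pair_in ?es_loopless ?best_cover_sub //.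
    rewrite mulnCA leq_mul2l ltnW ?orbT // ltnNge.
    exact: small.
  have le_sum : (#|choices V| <= #|homs (fun p => ~: cov p)| + \sum_(p <- es) #|bad p|)%N.
    apply: leq_trans (subset_leq_card cover_choices) _.
    apply: leq_trans (leq_card_setU _ _) _; rewrite leq_add2l.
    elim: (es) => [|p s IHs]; first by rewrite !big_nil cards0.
    rewrite !big_cons; apply: leq_trans (leq_card_setU _ _) _.
    by rewrite leq_add2l.
  have le_bad : (2 * \sum_(p <- es) #|bad p| <= #|choices V|)%N.
    rewrite -(leq_pmul2l es_gt0) mulnCA mulnA big_distrr /=.
    apply: (@leq_trans (\sum_(p <- es) #|choices V|)).
      rewrite big_seq [X in (_ <= X)%N]big_seq; exact: leq_sum.
    by rewrite big_const_seq count_predT iter_addn_0 mulnC.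
  rewrite -(leq_add2r #|choices V|) addnn -mul2n.
  apply: leq_trans (_ : _ <=
      2 * (#|homs (fun p => ~: cov p)| + \sum_(p <- es) #|bad p|))%N _.
    by rewrite leq_mul2l.
  by rewrite mulnDr leq_add2l.
rewrite ltNge => /negP[]; apply: (@homs_after_exchange (fun p => ~: cov p)).
- by rewrite divr_gt0 // ler_pdivrMr // mul1r.
- by rewrite -natrM ler_nat.
move=> p A B es_p sA sB large sparse.
have newE : ~: cov p :&: setX A B = setX A B :\: cov p by rewrite setIC setDE.
rewrite newE -cardsX in large; rewrite newE in sparse.
have beta2 : 2 * (beta / 2) = beta by field.
rewrite beta2 in sparse.
apply: (best_cover_maximal (G := G) (beta := beta) (gamma := gamma) sA sB);
  rewrite ?(ltW beta_gt0) ?(ltW gamma_gt0) //.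
rewrite -(ltr0n R); apply: lt_le_trans large.
by rewrite mulr_gt0 // ltr0n cardsX muln_gt0 !V_gt0.
Qed.

End Hybrid.

(** * Atoms of a set family and their refinement *)

Section Atoms.
Variable U : finType.
Implicit Types (SS : {set {set U}}) (u v : U).

Definition signature SS u : {set {set U}} := [set S in SS | u \in S].

(** The partition of the ordered pairs of vertices whose cells are the products
    of two atoms. *)
Definition psignature SS (p : U * U) := (signature SS p.1, signature SS p.2).

Definition atom SS u : {set U} := cell (signature SS) u.

Definition atoms SS : {set {set U}} := [set atom SS u | u in [set: U]].

Lemma mem_atom SS u : u \in atom SS u.
Proof. by rewrite inE. Qed.

Lemma atom_neq0 SS u : atom SS u != set0.
Proof. by apply/set0Pn; exists u; apply: mem_atom. Qed.

Lemma atom_in_atoms SS u : atom SS u \in atoms SS.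
Proof. by apply/imsetP; exists u. Qed.

Lemma atoms_neq0 SS A : A \in atoms SS -> A != set0.
Proof. by case/imsetP=> u _ ->; apply: atom_neq0. Qed.

Lemma card_atoms SS : (#|atoms SS| <= 2 ^ #|SS|)%N.
Proof.
rewrite -card_powerset.
have sub : atoms SS \subset [set [set v | signature SS v == s] | s in powerset SS].
  apply/subsetP=> A /imsetP[u _ ->]; apply/imsetP; exists (signature SS u) => //.
  by rewrite inE; apply/subsetP=> S; rewrite inE => /andP[].
exact: leq_trans (subset_leq_card sub) (leq_imset_card _ _).
Qed.

Lemma cell_psignature SS p : cell (psignature SS) p = setX (atom SS p.1) (atom SS p.2).
Proof. by apply/setP=> q; rewrite !inE xpair_eqE. Qed.

Lemma signature_sub SS SS' u v : SS \subset SS' ->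
  signature SS' u = signature SS' v -> signature SS u = signature SS v.
Proof.
move=> sSS /setP eqS; apply/setP=> S; rewrite !inE.
case SSS: (S \in SS) => //=.
by have := eqS S; rewrite !inE (subsetP sSS).
Qed.

Lemma mem_signature SS S u v : S \in SS ->
  signature SS u = signature SS v -> (u \in S) = (v \in S).
Proof. by move=> SSS /setP/(_ S); rewrite !inE SSS. Qed.

(** There are at most [2 ^ #|SS|] atoms, so those of size below a fixed share
    of the average contain few vertices together. *)
Lemma card_small_atoms (R : realFieldType) SS (kappa : R) : 0 <= kappa ->
  #|[set u | #|atom SS u|%:R < kappa * #|U|%:R / (2 ^ #|SS|)%:R]|%:R
    <= kappa * #|U|%:R.
Proof.
move=> kappa_ge0; set t := _ / _.
pose P := [set A in atoms SS | #|A|%:R < t].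
have sub : [set u | #|atom SS u|%:R < t] \subset cover P.
  apply/subsetP=> u; rewrite inE => ult; apply/bigcupP.
  by exists (atom SS u); rewrite ?mem_atom // inE ult atom_in_atoms.
have t_ge0 : 0 <= t by rewrite !mulr_ge0 ?invr_ge0.
apply: (@le_trans _ _ (\sum_(A in P) t)).
  apply: (@le_trans _ _ (\sum_(A in P) #|A|)%:R).
    by rewrite ler_nat (leq_trans (subset_leq_card sub)) ?leq_card_cover.
  rewrite natr_sum; apply: ler_sum => A; rewrite inE => /andP[_].
  exact: ltW.
rewrite sumr_const -[leLHS]mulr_natr; apply: (@le_trans _ _ (t * (2 ^ #|SS|)%:R)).
  rewrite ler_wpM2l // ler_nat; apply: leq_trans (card_atoms SS).
  by apply: subset_leq_card; apply/subsetP=> A; rewrite inE => /andP[].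
by rewrite /t divfK // pnatr_eq0 -lt0n expn_gt0.
Qed.

End Atoms.

Lemma leq_card_bigcup (I J : finType) (D : {set I}) (F : I -> {set J}) (k : nat) :
  (forall i, i \in D -> #|F i| <= k)%N -> (#|\bigcup_(i in D) F i| <= #|D| * k)%N.
Proof.
move=> leF; rewrite -sum_nat_const.
elim/big_rec2: _ => [|i n S Di IH]; first by rewrite cards0.
by apply: leq_trans (leq_card_setU _ _) _; rewrite leq_add ?leF.
Qed.

Section Refinement.
Variables (R : realType) (U : finType) (G : {set U * U}) (beta gamma : R).
Implicit Types (SS : {set {set U}}).

Let best := best_cover G beta gamma.
Let g (p : U * U) : R := (p \in G)%:R.

(** The best covers of all pairs of atoms are added, whether they are large or
    not; enlarging the family further never lowers the entropy. *)
Definition refine SS : {set {set U}} :=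
  SS :|: \bigcup_(P in setX (atoms SS) (atoms SS))
           \bigcup_(r in best P.1 P.2) [set r.1; r.2].

Lemma card_refine SS (m : nat) : 0 < gamma -> gamma^-1 <= m%:R ->
  (#|refine SS| <= #|SS| + 2 * 4 ^ #|SS| * m)%N.
Proof.
move=> gamma_gt0 le_m; apply: leq_trans (leq_card_setU _ _) _; rewrite leq_add2l.
apply: (@leq_trans (#|setX (atoms SS) (atoms SS)| * (m * 2))).
  apply: leq_card_bigcup => -[A B] /setXP[/atoms_neq0 A0 /atoms_neq0 B0] /=.
  apply: (@leq_trans (#|best A B| * 2)).
    by apply: leq_card_bigcup => r _; rewrite cards2; case: (_ != _).
  rewrite leq_mul2r /= -(ler_nat R).
  exact: le_trans (card_best_cover _ _ gamma_gt0 A0 B0) le_m.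
have -> : (2 * 4 ^ #|SS| * m = (2 ^ #|SS| * 2 ^ #|SS|) * (m * 2))%N.
  by rewrite -expnMn mulnAC [RHS]mulnC mulnC -mulnA mulnCA mulnA mulnC.
by rewrite leq_mul2r cardsX leq_mul ?card_atoms ?orbT.
Qed.

(** The cover of a pair of atoms is a union of cells of the refined partition,
    since the sides of its rectangles have been added to the family. *)
Lemma refine_gain SS (a0 c : R) : beta = a0 / 12 ->
  entropy (psignature SS) g + c / 2 *
    #|G :&: [set p | (a0 <= cavg (psignature SS) g p) &&
         (c * #|cell (psignature SS) p|%:R <=
            #|covered (best (atom SS p.1) (atom SS p.2))|%:R)]|%:R
  <= entropy (psignature (refine SS)) g.
Proof.
move=> betaE; set Sh := [set p | _].
pose cov p := covered (best (atom SS p.1) (atom SS p.2)).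
have cov_sub p : cov p \subset cell (psignature SS) p.
  by rewrite cell_psignature best_cover_sub.
have cov_eq p q : psignature SS p = psignature SS q -> cov p = cov q.
  by case=> /eq_cell e1 /eq_cell e2; rewrite /cov /atom e1 e2.
have Sh_eq p q : psignature SS p = psignature SS q -> (p \in Sh) = (q \in Sh).
  move=> pq; rewrite !inE (cavg_const g pq) (eq_cell pq).
  by have := cov_eq _ _ pq; rewrite /cov => ->.
have fine p q : psignature (refine SS) p = psignature (refine SS) q ->
    psignature SS p = psignature SS q.
  by case=> e1 e2; congr (_, _); [move: e1|move: e2];
    apply: signature_sub; apply: subsetUl.
have g_ge0 p : 0 <= g p by apply: ler0n.
pose C := [set p in Sh | p \in cov p].
have C_cell p : p \in Sh -> C :&: cell (psignature SS) p = cov p.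
  move=> Shp; apply/setP=> q; rewrite in_setI in_set.
  apply/andP/idP => [[/andP[_ qq]]|qp].
    by rewrite inE => /eqP /cov_eq <-.
  have cq := subsetP (cov_sub p) _ qp; split => //.
  by move: cq; rewrite inE => /eqP pq; rewrite (Sh_eq _ _ pq) Shp (cov_eq _ _ pq).
have -> : #|G :&: Sh|%:R = \sum_(p in Sh) g p :> R.
  rewrite -sum1_card natr_sum big_mkcond [RHS]big_mkcond.
  by apply: eq_bigr => p _; rewrite /g in_setI; case: (p \in G); case: (p \in Sh).
apply: (@entropy_gain _ _ _ _ _ _ C) => //.
- have covered_imp P p q : P \in setX (atoms SS) (atoms SS) ->
      psignature (refine SS) p = psignature (refine SS) q ->
      p \in covered (best P.1 P.2) -> q \in covered (best P.1 P.2).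
    move=> atP [e1 e2] /bigcupP[r br]; rewrite inE => /andP[p1 p2].
    have r_refine S : S \in [set r.1; r.2] -> S \in refine SS.
      move=> rS; apply/setUP; right; apply/bigcupP; exists P => //.
      by apply/bigcupP; exists r.
    apply/bigcupP; exists r => //.
    rewrite inE -(mem_signature _ e1) ?r_refine ?inE ?eqxx //.
    by rewrite -(mem_signature _ e2) ?r_refine ?inE ?eqxx ?orbT ?p1.
  move=> p q pq; have pq' := fine _ _ pq.
  rewrite !(in_set (fun p => _ && (p \in cov p))) (Sh_eq _ _ pq') (cov_eq _ _ pq').
  have atP : (atom SS q.1, atom SS q.2) \in setX (atoms SS) (atoms SS).
    by rewrite in_setX !atom_in_atoms.
  by congr (_ && _); apply/idP/idP; apply: (covered_imp _ _ _ atP).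
- by apply/subsetP=> p; rewrite inE => /andP[].
- by move=> p Shp; rewrite C_cell //; move: Shp; rewrite inE => /andP[].
- move=> p Shp; rewrite C_cell //.
  have -> : \sum_(q in cov p) g q = #|G :&: cov p|%:R.
    rewrite -sum1_card natr_sum big_mkcond [RHS]big_mkcond.
    by apply: eq_bigr => q _; rewrite /g in_setI; case: (q \in G); case: (q \in cov p).
  apply: le_trans (best_cover_sparse _ _ _ _ _) _; rewrite ler_wpM2r //.
  by move: Shp; rewrite inE betaE => /andP[le_a0 _]; rewrite ler_pM2r ?invr_gt0.
Qed.

End Refinement.

(** * Copies, embeddings and edge-disjoint packings *)

Section OrientedEdges.
Variables (T : finType) (H : sgraph T).

(** Each edge of [H] once, as an ordered pair, oriented by an arbitrary linear
    order of the vertices. *)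
Definition oriented_edges : seq (T * T) :=
  [seq p <- enum {: T * T} |
    ([set p.1; p.2] \in edges H) && (enum_rank p.1 < enum_rank p.2)%N].

Lemma edgeP e : e \in edges H -> exists x y, x != y /\ e = [set x; y].
Proof. by move/edges_card2/eqP/cards2P. Qed.

Lemma edge_neq x y : [set x; y] \in edges H -> x != y.
Proof. by move/edges_card2; rewrite cards2; case: eqP. Qed.

Lemma mem_oriented p : (p \in oriented_edges) =
  ([set p.1; p.2] \in edges H) && (enum_rank p.1 < enum_rank p.2)%N.
Proof. by rewrite mem_filter mem_enum andbT. Qed.

Lemma oriented_uniq : uniq oriented_edges.
Proof. by rewrite filter_uniq ?enum_uniq. Qed.

Lemma oriented_loopless p : p \in oriented_edges -> p.1 != p.2.
Proof. by rewrite mem_oriented => /andP[/edge_neq]. Qed.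

Lemma oriented_simple p q : p \in oriented_edges -> q \in oriented_edges ->
  p.1 \in [:: q.1; q.2] -> p.2 \in [:: q.1; q.2] -> q = p.
Proof.
case: p q => [a b] [c d]; rewrite !mem_oriented /= => /andP[_ ab] /andP[_ cd].
rewrite !inE => /orP[]/eqP ac /orP[]/eqP bd; move: ab cd; rewrite ac bd //.
- by rewrite ltnn.
- by move=> lt1 lt2; have := ltn_trans lt1 lt2; rewrite ltnn.
- by rewrite ltnn.
Qed.

Lemma oriented_edge x y : [set x; y] \in edges H ->
  (x, y) \in oriented_edges \/ (y, x) \in oriented_edges.
Proof.
move=> xyH; rewrite !mem_oriented /= (setUC [set y]) xyH /=.
have := edge_neq xyH; rewrite -(inj_eq enum_rank_inj) neq_ltn.
by case/orP; [left|right].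
Qed.

Lemma size_oriented_gt0 e : e \in edges H -> (0 < size oriented_edges)%N.
Proof.
move=> eH; have [x [y [_ xy]]] := edgeP eH; rewrite xy in eH.
by case: (oriented_edge eH); case: oriented_edges.
Qed.

Lemma size_oriented : (2 * size oriented_edges <= #|T| ^ 2)%N.
Proof.
rewrite -mulnn -card_prod mul2n -addnn.
have -> : (size oriented_edges + size oriented_edges)%N =
    size (oriented_edges ++ [seq (p.2, p.1) | p <- oriented_edges]).
  by rewrite size_cat size_map.
rewrite cardE; apply: uniq_leq_size => [|p _]; last by rewrite mem_enum.
rewrite cat_uniq oriented_uniq map_inj_uniq ?oriented_uniq => [|[a b] [c d] [-> ->] //].
rewrite andbT; apply/hasPn=> p /mapP[q]; rewrite !mem_oriented => /andP[_ lt] -> /=.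
by rewrite negb_and -leqNgt ltnW ?orbT.
Qed.

End OrientedEdges.

Section Copies.
Variables (T U : finType) (H : sgraph T).
Implicit Types G : sgraph U.

Lemma copyP G S : S \in copies H G -> exists f : {ffun T -> U},
  [/\ injective f,
      (forall x y, [set x; y] \in edges H -> [set f x; f y] \in S.2) &
      (forall e, e \in S.2 ->
         exists2 p, p \in oriented_edges H & e = [set f p.1; f p.2])].
Proof.
rewrite inE => /andP[/andP[/subsetP sG /subsetP sV]].
case/existsP=> f /and3P[/injectiveP f_inj /eqP fS /forallP fE].
have edgeE x y : ([set x; y] \in edges H) = ([set f x; f y] \in S.2).
  by move/forallP/(_ y)/eqP: (fE x).
exists f; split=> // [x y|e eS]; first by rewrite edgeE.
have [a [b [ab eab]]] := edgeP (sG _ eS).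
have := sV _ eS; rewrite inE eab subUset !sub1set -fS.
case/andP=> /imsetP[x _ ax] /imsetP[y _ bY]; rewrite ax bY in eab *.
have : [set x; y] \in edges H by rewrite edgeE -eab.
case/oriented_edge => [xy|yx]; first by exists (x, y).
by exists (y, x) => //=; rewrite setUC.
Qed.

Lemma embedding_copy G (v : {ffun T -> U}) : injective v ->
    (forall p, p \in oriented_edges H -> [set v p.1; v p.2] \in edges G) ->
  (v @: [set: T], [set v @: (e : {set T}) | e in edges H]) \in copies H G.
Proof.
move=> v_inj v_hom; rewrite inE; apply/andP; split.
  apply/andP; split=> /=; apply/subsetP=> _ /imsetP[e eH ->]; last first.
    by rewrite inE imsetS ?subsetT.
  have [x [y [xy exy]]] := edgeP eH; rewrite exy imsetU1 imset_set1.
  rewrite exy in eH; case: (oriented_edge eH) => /v_hom //=.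
  by rewrite setUC.
apply/existsP; exists v; rewrite eqxx /=; apply/andP; split; first exact/injectiveP.
apply/forallP=> x; apply/forallP=> y; apply/eqP.
rewrite -[X in _ = (X \in _)](_ : v @: [set x; y] = _); last first.
  by rewrite imsetU1 imset_set1.
by rewrite mem_imset //; apply: imset_inj.
Qed.

(** A copy on the vertex set [S.1] is the image only of maps into [S.1]. *)
Lemma card_embeddings G : (#|[set v : {ffun T -> U} | injectiveb v &&
    all (fun p => [set v p.1; v p.2] \in edges G) (oriented_edges H)]|
  <= #|copies H G| * #|T| ^ #|T|)%N.
Proof.
set D := [set v | _].
apply: (@leq_trans #|\bigcup_(S in [set S in copies H G | #|S.1| == #|T|])
    choices (fun=> S.1)|).
  apply: subset_leq_card; apply/subsetP=> v; rewrite inE => /andP[/injectiveP v_inj].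
  move/allP=> v_hom; apply/bigcupP.
  exists (v @: [set: T], [set v @: (e : {set T}) | e in edges H]).
    by rewrite inE embedding_copy //= card_imset // cardsT.
  by apply/choicesP=> k /=; apply: imset_f.
apply: leq_trans (leq_card_bigcup (k := #|T| ^ #|T|) _) _ => [S|].
  rewrite inE => /andP[_ /eqP cS].
  by rewrite card_choices prod_nat_const cS.
rewrite leq_mul2r subset_leq_card ?orbT //.
by apply/subsetP=> S; rewrite inE => /andP[].
Qed.

(** Each of the at most [h ^ 2] possible coincidences of values has probability
    [1 / n]. *)
Lemma card_noninjective :
  (#|[set v : {ffun T -> U} | ~~ injectiveb v]| * #|U| <= #|T| ^ 2 * #|U| ^ #|T|)%N.
Proof.
pose same (q : T * T) := [set v : {ffun T -> U} | v q.1 == v q.2].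
have card_same q : q.1 != q.2 -> (#|same q| * #|U| = #|U| ^ #|T|)%N.
  move=> xy; pose C := [set p : U * U | p.1 == p.2].
  have sub_C : C \subset setX [set: U] [set: U] by apply/subsetP=> p; rewrite !inE.
  have := count_pair_in (V := fun=> [set: U]) xy sub_C.
  have -> : [set v in choices (fun=> [set: U]) | (v q.1, v q.2) \in C] = same q.
    apply/setP=> v; rewrite !inE /=; case: eqP; rewrite ?andbF ?andbT //.
    by move=> _; apply/forallP=> k; rewrite inE.
  rewrite card_choices prod_nat_const cardsT.
  have -> : #|C| = #|U|.
    have -> : C = [set (u, u) | u in [set: U]].
      apply/setP=> -[u v]; rewrite inE /=; apply/eqP/imsetP=> [->|[w _ [-> ->]] //].
      by exists v.
    by rewrite card_imset ?cardsT // => u v [].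
  have [-> //|U_gt0] := posnP #|U|; last first.
    by rewrite mulnA => /eqP; rewrite eqn_pmul2r // => /eqP.
  rewrite !muln0 => _.
  by case: #|T| (fintype0 q.1) => [//|m _]; rewrite exp0n.
apply: (@leq_trans (#|\bigcup_(q in [set q : T * T | q.1 != q.2]) same q| * #|U|)).
  rewrite leq_mul2r; apply/orP; right; apply: subset_leq_card.
  apply/subsetP=> v; rewrite inE => /injectivePn[x [y xy vxy]].
  by apply/bigcupP; exists (x, y); rewrite inE //= vxy.
(* By [card_same] the division is exact whenever there is a pair to count. *)
have [->|U_gt0] := posnP #|U|; first by rewrite muln0.
apply: (@leq_trans (#|T| ^ 2 * (#|U| ^ #|T| %/ #|U|) * #|U|)).
  rewrite leq_mul2r; apply/orP; right.
  apply: leq_trans (leq_card_bigcup (k := #|U| ^ #|T| %/ #|U|) _) _ => [q|].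
    rewrite inE => xy; rewrite -(card_same q xy) mulnK //.
  rewrite leq_mul2r -mulnn -card_prod max_card orbT //.
by rewrite -mulnA leq_mul2l leq_trunc_div orbT.
Qed.

(** A copy that survives the deletion of a largest packing would be edge-disjoint
    from it. It could be added, since a copy of a graph with an edge is not
    itself disjoint from its own edge set. *)
Lemma exists_packing G : (exists e, e \in edges H) ->
  exists K : {set {set U} * {set {set U}}},
    [/\ K \subset copies H G,
        (forall S S', S \in K -> S' \in K -> S != S' -> [disjoint S.2 & S'.2]) &
        free_of H (remove_edges G (\bigcup_(S in K) S.2))].
Proof.
case=> e0 e0H.
pose packing (K : {set {set U} * {set {set U}}}) := (K \subset copies H G) &&
  [forall S in K, forall S' in K, (S != S') ==> [disjoint S.2 & S'.2]].
have packing0 : packing set0.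
  by rewrite /packing sub0set; apply/forall_inP=> S; rewrite inE.
have [K /andP[sK disK] Kmax] := @arg_maxnP _ set0 packing (fun K => #|K|) packing0.
have {}disK S S' : S \in K -> S' \in K -> S != S' -> [disjoint S.2 & S'.2].
  move=> SK S'K; apply/implyP.
  by move/forall_inP/(_ _ SK)/forall_inP/(_ _ S'K): disK.
exists K; split=> // S; apply/negP=> copyS.
set F := \bigcup_(S in K) S.2 in copyS.
have [f [f_inj f_edge _]] := copyP copyS.
have S2_neq0 : exists e, e \in S.2.
  by have [x [y [_ xy]]] := edgeP e0H; rewrite xy in e0H;
    exists [set f x; f y]; apply: f_edge.
move: copyS; rewrite inE => /andP[/andP[sGF sV] iso].
have disF : [disjoint S.2 & F].
  apply/pred0P=> e /=; apply/andP=> -[eS eF].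
  by have := subsetP sGF _ eS; rewrite inE eF.
have dis_S S' : S' \in K -> [disjoint S.2 & S'.2].
  by move=> S'K; apply: disjointWr disF; apply: (bigcup_sup S').
have SnK : S \notin K.
  apply/negP=> /dis_S; rewrite -setI_eq0 setIid => /eqP S0.
  by have [e] := S2_neq0; rewrite S0 inE.
have : packing (S |: K).
  apply/andP; split.
    rewrite subUset sK andbT sub1set inE iso andbT /is_subgraph sV andbT.
    by apply: subset_trans sGF _; apply: subsetDl.
  apply/forall_inP=> A /setU1P AK; apply/forall_inP=> B /setU1P BK; apply/implyP.
  case: AK BK => [->|AK] [->|BK]; first by rewrite eqxx.
  - by move=> _; apply: dis_S.
  - by move=> _; rewrite disjoint_sym; apply: dis_S.
  exact: disK.
by move/Kmax; rewrite cardsU1 SnK /= ltnn.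
Qed.

End Copies.

(** * Entropy gained by one refinement *)

Section Packing.
Variables (R : realType) (T U : finType) (H : sgraph T) (G : sgraph U).
Variable K : {set {set U} * {set {set U}}}.
Hypothesis K_copies : K \subset copies H G.
Hypothesis K_disjoint :
  forall S S', S \in K -> S' \in K -> S != S' -> [disjoint S.2 & S'.2].

Let F := \bigcup_(S in K) S.2.
Let es := oriented_edges H.

Definition arcs : {set U * U} := [set p | [set p.1; p.2] \in F].

Lemma packing_edges_sub : F \subset edges G.
Proof.
apply/bigcupsP=> S /(subsetP K_copies); rewrite inE => /andP[/andP[]].
by [].
Qed.

(** Every edge lies in at most one copy of the packing. *)
Lemma packing_hits (B : {set U * U}) :
    (forall S, S \in K -> exists2 p, p \in B & [set p.1; p.2] \in S.2) ->
  (#|K| <= #|B|)%N.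
Proof.
move=> hit; rewrite -sum1_card -[leqRHS]sum1_card.
apply: (@leq_trans (\sum_(S in K) \sum_(p in B) ([set p.1; p.2] \in S.2))).
  apply: leq_sum => S /hit[p Bp pS].
  by rewrite (bigD1 p) //= pS.
rewrite exchange_big /=; apply: leq_sum => p _.
have [S /andP[SK pS]|none] := pickP [pred S in K | [set p.1; p.2] \in S.2]; last first.
  by rewrite big1 // => S SK; have := none S; rewrite /= SK /= => ->.
rewrite (bigD1 S) //= pS big1 // => S' /andP[S'K S'S].
by rewrite (disjointFl (K_disjoint S'K SK S'S) pS).
Qed.

Lemma card_packing : (#|F| <= #|K| * size es)%N.
Proof.
apply: leq_card_bigcup => S /(subsetP K_copies)/copyP[f [_ _ sub]].
rewrite -(size_map (fun p : T * T => [set f p.1; f p.2])) cardE.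
apply: uniq_leq_size (enum_uniq _) _ => e; rewrite mem_enum => /sub[p es_p ->].
exact: (map_f (fun p : T * T => [set f p.1; f p.2])).
Qed.

Lemma card_arcs_le : (#|arcs| <= 2 * #|F|)%N.
Proof.
pose ends (e : {set U}) := [set p : U * U | [set p.1; p.2] == e].
have -> : arcs = \bigcup_(e in F) ends e.
  apply/setP=> p; rewrite inE; apply/idP/bigcupP=> [pF|[e eF]].
    by exists [set p.1; p.2]; rewrite ?inE.
  by rewrite inE => /eqP->.
rewrite mulnC; apply: leq_card_bigcup => e /(subsetP packing_edges_sub) eG.
have [a [b [ab eab]]] := edgeP eG.
apply: (@leq_trans #|[set (a, b); (b, a)]|); last by rewrite cards2; case: (_ == _).
apply: subset_leq_card; apply/subsetP=> -[x y]; rewrite inE /= => /eqP xy.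
have xney : x != y by apply: (@edge_neq _ G); rewrite xy.
have : x \in e by rewrite -xy set21.
have : y \in e by rewrite -xy set22.
rewrite eab !inE !xpair_eqE => /orP[]/eqP yE /orP[]/eqP xE; move: xney;
  by rewrite xE yE ?eqxx ?orbT.
Qed.

Lemma card_arcs_ge : (#|F| <= #|arcs|)%N.
Proof.
apply: leq_trans (leq_imset_card (fun p : U * U => [set p.1; p.2]) arcs).
apply: subset_leq_card; apply/subsetP=> e eF.
have [a [b [_ eab]]] := edgeP (subsetP packing_edges_sub _ eF).
by apply/imsetP; exists (a, b); rewrite // inE /= -eab.
Qed.

Let e := size es.
Let g (p : U * U) : R := (p \in arcs)%:R.

(** Call an arc bad if it joins atoms of density below [a0] or starts in a small
    atom; there are at most [2 a0 n^2] bad pairs, which is the loss term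
    [eps / (4 e) n^2]. In a copy of the packing without bad arcs the
    vertices of positive degree lie in large atoms. Few homomorphisms respect
    such a choice of atoms, so one of its edges joins two atoms
    with a large cover. The copies without bad arcs thus provide as many
    different edges on which entropy is gained. *)
Lemma packing_gain (eps : R) (SS : {set {set U}}) :
  let a0 := eps / (8 * e%:R) in let beta := a0 / 12 in
  let gamma := (beta / 2) ^+ e / 4 in
    (0 < e)%N -> 0 < eps < 1 ->
    (forall V : T -> {set U},
       (forall k, a0 * #|U|%:R / (2 ^ #|SS|)%:R <= #|V k|%:R) ->
     #|homs V es (fun=> arcs)|%:R < (beta / 2) ^+ e / 2 * #|choices V|%:R) ->
  entropy (psignature SS) g +
     (4 * e%:R)^-1 * (#|K|%:R - eps / (4 * e%:R) * #|U|%:R ^+ 2)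
  <= entropy (psignature (refine arcs beta gamma SS)) g.
Proof.
move=> a0 beta gamma e_gt0 /andP[eps_gt0 eps_lt1] few.
have e_gt0' : 0 < e%:R :> R by rewrite ltr0n.
have e_ge1 : 1 <= e%:R :> R by rewrite ler1n.
have a0_gt0 : 0 < a0 by rewrite divr_gt0 ?mulr_gt0.
have a0_le1 : a0 <= 1 by rewrite ler_pdivrMr ?mulr_gt0 // mul1r; lra.
have beta_gt0 : 0 < beta by rewrite divr_gt0.
have beta_le2 : beta <= 2 by rewrite ler_pdivrMr //; lra.
pose w := cavg (psignature SS) g.
pose small := [set u | #|atom SS u|%:R < a0 * #|U|%:R / (2 ^ #|SS|)%:R].
pose sparse := [set p | w p < a0].
pose c : R := (2 * e%:R)^-1.
pose Sh := [set p | (a0 <= w p) && (c * #|cell (psignature SS) p|%:R <=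
   #|covered (best_cover arcs beta gamma (atom SS p.1) (atom SS p.2))|%:R)].
have hit S : S \in K -> exists2 p,
    p \in (arcs :&: sparse) :|: setX small [set: U] :|: (arcs :&: Sh) &
    [set p.1; p.2] \in S.2.
  move=> SK; have [f [f_inj f_edge _]] := copyP (subsetP K_copies _ SK).
  have arcS x y : [set x; y] \in edges H -> (f x, f y) \in arcs.
    by move=> /f_edge fxy; rewrite inE; apply/bigcupP; exists S.
  have [/existsP[x /existsP[y /andP[xyH small_x]]]|no_small] :=
      boolP [exists x, exists y, ([set x; y] \in edges H) && (f x \in small)].
    exists (f x, f y); last exact: f_edge.
    by rewrite !in_setU in_setX small_x in_setT orbT.
  have large x y : [set x; y] \in edges H ->
      a0 * #|U|%:R / (2 ^ #|SS|)%:R <= #|atom SS (f x)|%:R.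
    move=> xyH; rewrite leNgt; apply: contra no_small => lt.
    by apply/existsP; exists x; apply/existsP; exists y; rewrite xyH inE.
  have [/hasP[q es_q q_sparse]|/hasPn dense] :=
      boolP (has (fun q => w (f q.1, f q.2) < a0) es).
    have qH : [set q.1; q.2] \in edges H by move: es_q; rewrite mem_oriented => /andP[].
    exists (f q.1, f q.2); last exact: f_edge.
    by rewrite !in_setU in_setI arcS // [_ \in sparse]inE q_sparse.
  (* An isolated vertex of [H] may well lie in a small atom, but it is free to
     move in the whole vertex set. *)
  pose V k := if [exists y, [set k; y] \in edges H] then atom SS (f k) else setT.
  have V_neq0 k : V k != set0.
    rewrite /V; case: ifP => _; first exact: atom_neq0.
    by apply/set0Pn; exists (f k).
  have few_V : #|homs V es (fun=> arcs)|%:R < (beta / 2) ^+ e / 2 * #|choices V|%:R.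
    apply: few => k; rewrite /V; case: ifP => [/existsP[y]|_]; first exact: large.
    rewrite cardsT ler_pdivrMr ?ltr0n ?expn_gt0 //.
    apply: (@le_trans _ _ (1 * #|U|%:R)); first by rewrite ler_wpM2r.
    by rewrite mul1r ler_peMr // ler1n expn_gt0.
  have beta02 : 0 < beta <= 2 by rewrite beta_gt0.
  have [q es_q large_cover] := few_homs_cover (@oriented_uniq _ H)
    (@oriented_loopless _ H) (@oriented_simple _ H) V_neq0 e_gt0 beta02 few_V.
  have qH : [set q.1; q.2] \in edges H by move: es_q; rewrite mem_oriented => /andP[].
  have V1 : V q.1 = atom SS (f q.1).
    by rewrite /V; case: existsP => // -[]; exists q.2.
  have V2 : V q.2 = atom SS (f q.2).
    by rewrite /V; case: existsP => // -[]; exists q.1; rewrite setUC.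
  exists (f q.1, f q.2); last exact: f_edge.
  rewrite !in_setU [_ \in arcs :&: Sh]in_setI arcS // [_ \in Sh]inE.
  rewrite leNgt dense //= cell_psignature /= /c ler_pdivrMl ?mulr_gt0 //.
  move: large_cover; rewrite V1 V2 -(ler_nat R) !natrM cardsX natrM => ->.
  by rewrite !orbT.
have := @refine_gain R U arcs beta gamma SS a0 c erefl.
apply: le_trans; rewrite -/w -/Sh lerD2l.
have -> : c / 2 = (4 * e%:R)^-1 by rewrite /c; field; rewrite gt_eqF.
rewrite ler_wpM2l ?invr_ge0 ?mulr_ge0 // lerBlDr.
have le_sparse : #|arcs :&: sparse|%:R <= a0 * #|U|%:R ^+ 2.
  have -> : #|arcs :&: sparse|%:R = \sum_(p | w p < a0) g p.
    rewrite -sum1_card natr_sum big_mkcond [RHS]big_mkcond /=.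
    by apply: eq_bigr => p _; rewrite in_setI [_ \in sparse]inE /g;
      case: (p \in arcs); case: (w p < a0).
  have := sum_sparse_cells (psignature SS) g (ltW a0_gt0).
  by rewrite card_prod natrM -expr2.
have le_small : #|setX small [set: U]|%:R <= a0 * #|U|%:R ^+ 2.
  rewrite cardsX cardsT natrM expr2 mulrA ler_wpM2r //.
  exact: card_small_atoms (ltW a0_gt0).
have : #|K|%:R <=
    #|arcs :&: sparse|%:R + #|setX small [set: U]|%:R + #|arcs :&: Sh|%:R :> R.
  rewrite -!natrD ler_nat; apply: leq_trans (packing_hits hit) _.
  apply: leq_trans (leq_card_setU _ _) _; rewrite leq_add2r.
  exact: leq_card_setU.
have -> : eps / (4 * e%:R) = a0 + a0 by rewrite /a0; field; rewrite gt_eqF.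
rewrite mulrDl; lra.
Qed.

End Packing.

(** * Towers and the size of the parameters *)

Lemma leq_tow m n : (m <= n)%N -> (tow m <= tow n)%N.
Proof.
move=> /subnK <-; elim: (n - m)%N => [//|k IHk]; rewrite addSn /=.
by apply: leq_trans IHk _; rewrite ltnW // ltn_expl.
Qed.

Lemma ltn_tow n : (n < tow n)%N.
Proof. by elim: n => //= n IHn; apply: leq_ltn_trans IHn _; rewrite ltn_expl. Qed.

Lemma sqr_le_exp b : (13 <= b)%N -> (4 * b ^ 2 <= 2 ^ b.-1)%N.
Proof.
move=> /subnK <-; rewrite addnS /=; elim: (b - 13)%N => [//|k IHk].
rewrite !addSn [leqRHS]expnS; apply: leq_trans _ (leq_mul (leqnn 2) IHk).
rewrite -!mulnn; nia.
Qed.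

(** A slack that dominates every quantity depending only on the parameters. It
    is kept below the current tower during the whole iteration. *)
Definition tower_margin b := (2 ^ (4 * b ^ 2))%N.

Lemma tower_margin_le b : (13 <= b)%N -> (tower_margin b <= tow b)%N.
Proof.
case: b => [//|[//|b]] b_ge; rewrite /tower_margin /= leq_exp2l //.
apply: leq_trans (sqr_le_exp b_ge) _; rewrite leq_exp2l //=.
exact: ltn_tow.
Qed.

(** One refinement, with [gamma^-1] bounded by [2 ^ (3 b^2 + 2)], costs one
    exponential. *)
Lemma tower_step b s s' : (13 <= b)%N ->
    (s' <= s + 2 * 4 ^ s * 2 ^ (3 * b ^ 2 + 2))%N ->
  (4 * s' + tower_margin b <= 2 ^ (4 * s + tower_margin b))%N.
Proof.
move=> b_ge le_s'.
have b2_ge : (169 <= b ^ 2)%N by rewrite -mulnn; nia.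
have s_lt : (s <= 4 ^ s)%N by rewrite ltnW // ltn_expl.
have m_le : (4 * 2 * 2 ^ (3 * b ^ 2 + 2) + 4 <= tower_margin b)%N.
  have -> : (4 * 2 = 2 ^ 3)%N by [].
  apply: (@leq_trans (2 ^ (3 + (3 * b ^ 2 + 2)) + 2 ^ (3 + (3 * b ^ 2 + 2)))).
    by rewrite -expnD leq_add2l -[4%N]/(2 ^ 2)%N leq_exp2l.
  by rewrite addnn -mul2n -expnS leq_exp2l //; lia.
have margin_gt0 : (0 < tower_margin b)%N by rewrite expn_gt0.
apply: (@leq_trans (4 ^ s * (2 * tower_margin b))).
  have le4 := leq_mul (leqnn 4) le_s'.
  have : (4 * s <= 4 * 4 ^ s)%N by rewrite leq_mul2l.
  have : (tower_margin b <= 4 ^ s * tower_margin b)%N.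
    by rewrite leq_pmull // expn_gt0.
  have := leq_mul (leqnn (4 ^ s)%N) m_le.
  move: le4; move: (4 ^ s)%N (2 ^ _)%N (tower_margin b) => p q t.
  rewrite !mulnDr; nia.
rewrite expnD; apply: leq_mul.
  by rewrite -[4%N]/(2 ^ 2)%N -expnM leq_exp2l // leq_mul2r orbT.
rewrite /tower_margin -expnS leq_exp2l //.
exact: ltn_expl.
Qed.

(** Thanks to the margin, a second exponential exceeds all that is needed to
    count homomorphisms into atoms of a family of [s] sets. *)
Lemma tower_room b s : (13 <= b)%N ->
  (b * (b + (1 + 6 * b ^ 2 + s * b) + 2) + (1 + 6 * b ^ 2 + s * b) + 2
    <= 2 ^ (4 * s + tower_margin b))%N.
Proof.
move=> b_ge; apply: (@leq_trans ((s + 1) * (2 ^ 5 * (b * b * b)))).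
  rewrite -mulnn -[(2 ^ 5)%N]/32%N; nia.
rewrite expnD; apply: leq_mul.
  rewrite addn1; apply: leq_trans (ltn_expl s (isT : 1 < 2)%N) _.
  by rewrite leq_exp2l // leq_pmull.
have lt_b : (b <= 2 ^ b)%N by rewrite ltnW // ltn_expl.
apply: (@leq_trans (2 ^ (5 + (b + b + b)))).
  by rewrite !expnD leq_mul2l !leq_mul ?orbT.
rewrite leq_exp2l // ltnW //; apply: leq_ltn_trans (ltn_expl _ (isT : 1 < 2)%N).
rewrite -mulnn; nia.
Qed.

(** The homomorphisms [N] are the injective ones, at most [h ^ h] for each of
    the [C] copies, and the others. Both are negligible: the number of copies
    by the factor [2 ^ Q], the others because [n] is large. That [n] is large
    follows from there being a copy at all. *)
Lemma few_homs_arith h b s n C N Q :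
    (0 < h <= b)%N -> (h ^ 2 <= 2 ^ b)%N -> (0 < C)%N ->
    let Z := (1 + 6 * b ^ 2 + s * b)%N in
    (b * (b + Z + 2) + Z + 2 <= Q)%N -> (2 ^ Q * C <= n ^ h)%N ->
    (N * n <= C * h ^ h * n + h ^ 2 * n ^ h)%N ->
  (N * 2 ^ Z < n ^ h)%N.
Proof.
move=> /andP[h_gt0 le_hb] h2_le C_gt0 Z Q_large nh_large le_N.
have le_h2b : (h <= 2 ^ b)%N.
  by apply: leq_trans h2_le; rewrite -mulnn leq_pmulr.
have hh_le : (h ^ h * 2 ^ (Z + 2) <= 2 ^ Q)%N.
  apply: (@leq_trans (2 ^ (b * b + (Z + 2)))).
    rewrite [leqRHS]expnD leq_mul2r expnM; apply/orP; right.
    apply: leq_trans (leq_pexp2l _ le_hb); rewrite ?expn_gt0 //.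
    by rewrite leq_exp2r.
  by rewrite leq_exp2l //; nia.
have n_large : (h ^ 2 * 2 ^ (Z + 2) <= n)%N.
  rewrite leqNgt; apply/negP=> lt_n.
  have : (n ^ h < 2 ^ Q)%N.
    apply: leq_trans (_ : (h ^ 2 * 2 ^ (Z + 2)) ^ h <= _)%N.
      by rewrite ltn_exp2r.
    apply: (@leq_trans ((2 ^ (b + (Z + 2))) ^ h)).
      by rewrite leq_exp2r // [leqRHS]expnD leq_mul2r h2_le orbT.
    by rewrite -expnM leq_exp2l //; nia.
  rewrite ltnNge => /negP[]; apply: leq_trans nh_large.
  by rewrite leq_pmulr.
have n_gt0 : (0 < n)%N.
  by apply: leq_trans n_large; rewrite muln_gt0 !expn_gt0 h_gt0.
have nh_gt0 : (0 < n ^ h)%N by rewrite expn_gt0 n_gt0.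
have : (N * 2 ^ (Z + 2) * n <= 2 * (n ^ h) * n)%N.
  apply: (@leq_trans ((C * h ^ h * n + h ^ 2 * n ^ h) * 2 ^ (Z + 2))).
    by rewrite mulnAC leq_mul2r le_N orbT.
  have := leq_mul (leqnn (C * n)%N) hh_le.
  have := leq_mul (leqnn n) nh_large.
  have := leq_mul (leqnn (n ^ h)%N) n_large.
  move: (2 ^ (Z + 2))%N (2 ^ Q)%N (n ^ h)%N (h ^ h)%N (h ^ 2)%N => z q m k l; nia.
rewrite leq_pmul2r // expnD -[(2 ^ 2)%N]/4%N.
move: (2 ^ Z)%N (n ^ h)%N nh_gt0 => z m; nia.
Qed.

(** Of the height [5 y] with [y = h ^ 4 ln eps^-1], just over [3 y] levels are
    spent on the refinements and about [2 y] on the parameter [b]. Since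
    [eps < 1/2] and [h >= 2] give [y > 8], the latter bounds both [h ^ 4] and
    the binary logarithm of [eps^-1]. *)
Lemma height_parameters (R : realType) (h : nat) (eps : R) :
    (2 <= h)%N -> 0 < eps < 2^-1 ->
  exists b N : nat, [/\ (13 <= b)%N, (h ^ 4 <= b + 3)%N, eps^-1 <= (2 ^ b)%:R,
    (b + N + 2 <= removal_height h eps)%N & 3 * h%:R ^+ 4 * ln eps^-1 < N%:R].
Proof.
move=> h_ge2 /andP[eps_gt0 eps_lt]; rewrite /removal_height.
set x := ln _; set y := h%:R ^+ 4 * x.
have ln2_ge : 2^-1 <= ln 2 :> R.
  have := ln_le_sub1 (t := 2^-1 : R); rewrite invr_gt0 ltr0n => /(_ isT).
  by rewrite lnV ?posrE //; lra.
have x_gt : 2^-1 < x.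
  apply: le_lt_trans ln2_ge _; rewrite /x ltr_ln ?posrE ?invr_gt0 //.
  by rewrite -[ltLHS]invrK ltf_pV2 ?posrE ?invr_gt0.
have x_gt0 : 0 < x by apply: lt_trans x_gt; rewrite invr_gt0.
have h4_ge : 16 <= h%:R ^+ 4 :> R.
  by rewrite -natrX (_ : 16 = (2 ^ 4)%:R) // ler_nat leq_exp2r.
have h4_lt : h%:R ^+ 4 < 2 * y by rewrite /y mulrCA ltr_pMr; [lra|lra].
have x_le : 16 * x <= y by rewrite ler_wpM2r // ltW.
have y_gt : 8 < y by lra.
(* [b] is three below the integral part of [2 y]; these three levels pay for
   rounding [3 y] up and for the two exponentials of the final count. *)
have B_itv : (Num.trunc (2 * y))%:R <= 2 * y < (Num.trunc (2 * y)).+1%:R.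
  by apply: truncn_itv; lra.
have N_itv : (Num.trunc (3 * y))%:R <= 3 * y < (Num.trunc (3 * y)).+1%:R.
  by apply: truncn_itv; lra.
move: B_itv N_itv; set B := Num.trunc _; set N := Num.trunc _.
rewrite -[B.+1%:R]natr1 -[N.+1%:R]natr1 => /andP[B_le B_gt] /andP[N_le N_gt].
have B_ge : (16 <= B)%N by rewrite -ltnS -(ltr_nat R) -natr1; lra.
move: B_le B_gt; rewrite -(subnK (leq_trans (isT : 3 <= 16)%N B_ge)).
have b_ge : (13 <= B - 3)%N by rewrite leq_subRL // (leq_trans _ B_ge).
move: (B - 3)%N b_ge => b b_ge; rewrite natrD => b_le b_gt.
have b_ge' : 13 <= b%:R :> R by rewrite ler_nat.
exists b, N.+1; split=> //.
- by rewrite -ltnS -(ltr_nat R) natrX -natr1 natrD; lra.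
- rewrite -ler_ln ?posrE ?invr_gt0 ?ltr0n ?expn_gt0 // natrX lnXn // -/x.
  rewrite -[leRHS]mulr_natr.
  have : 2^-1 * b%:R <= ln 2 * b%:R :> R by rewrite ler_wpM2r.
  by apply: le_trans; lra.
- rewrite -(ler_nat R) natr_absz; apply: (@le_trans _ _ (5 * y)).
    by rewrite !natrD -natr1; lra.
  rewrite /y mulrA; apply: le_trans (ceil_ge _) _.
  by rewrite ler_int ler_norm.
- by rewrite -mulrA -[ltRHS]natr1; exact: N_gt.
Qed.

Lemma double_card_edges (U : finType) (G : sgraph U) (F : {set {set U}}) :
  F \subset edges G -> (2 * #|F| <= #|U| ^ 2)%N.
Proof.
move=> sFG; have : (#|F| <= 'C(#|U|, 2))%N.
  rewrite -card_draws; apply: subset_leq_card; apply/subsetP=> e eF.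
  by rewrite inE (edges_card2 (subsetP sFG _ eF)).
rewrite -(leq_pmul2l (isT : 0 < 2)%N) => /leq_trans; apply.
rewrite mulnC (bin_ffact _ 2 : 'C(_, 2) * 2 = _)%N ffactnS ffactn1 -mulnn.
by rewrite leq_mul2l leq_pred orbT.
Qed.

Lemma parameter_bounds (R : realFieldType) (h e b : nat) (eps : R) :
    (2 <= h)%N -> (13 <= b)%N -> (h ^ 4 <= b + 3)%N -> (2 * e <= h ^ 2)%N ->
    (0 < e)%N -> 0 < eps -> eps^-1 <= (2 ^ b)%:R ->
  [/\ (h <= b)%N, (h ^ 2 <= 2 ^ b)%N, (e <= b)%N &
      ((2 ^ (3 * b))%:R)^-1 <= eps / (8 * e%:R) / 12 / 2].
Proof.
move=> h_ge b_ge h4_le e_le e_gt0 eps_gt0 eps_ge.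
have lt_b : (b < 2 ^ b)%N by rewrite ltn_expl.
have h2_le : (h ^ 2 * 4 <= b + 3)%N.
  apply: leq_trans h4_le; rewrite (expnD h 2 2) leq_mul2l.
  by rewrite (leq_exp2r 2 h (isT : 0 < 2)%N) h_ge orbT.
have e_le_b : (e <= b)%N by move: (h ^ 2)%N e_le h2_le => k; lia.
split=> //.
- by move: h2_le; rewrite -mulnn; nia.
- by apply: leq_trans (ltnW lt_b); lia.
have e_gt0' : 0 < e%:R :> R by rewrite ltr0n.
have -> : eps / (8 * e%:R) / 12 / 2 = ((192 * e)%:R * eps^-1)^-1.
  by rewrite natrM; field; rewrite !gt_eqF.
rewrite lef_pV2 ?posrE ?mulr_gt0 ?invr_gt0 ?ltr0n ?expn_gt0 ?muln_gt0 //.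
apply: (@le_trans _ _ ((2 ^ (b + b))%:R * (2 ^ b)%:R)).
  apply: ler_pM; rewrite ?invr_ge0 ?(ltW eps_gt0) //.
  rewrite ler_nat expnD leq_mul //; last exact: leq_trans (ltnW lt_b).
  apply: (@leq_trans (2 ^ 8)%N) => //.
  by rewrite leq_exp2l // (leq_trans _ b_ge).
by rewrite -natrM -expnD ler_nat leq_exp2l //; lia.
Qed.

(** * The removal lemma *)

Section FewHoms.
Variables (R : realType) (T U : finType) (H : sgraph T) (G : sgraph U).
Variable K : {set {set U} * {set {set U}}}.
Hypothesis K_copies : K \subset copies H G.
Let es := oriented_edges H.

(** An injective homomorphism into [F] is an embedding into [G]. *)
Lemma card_homs_arcs (V : T -> {set U}) :
  (#|homs V es (fun=> arcs K)| * #|U| <=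
     #|copies H G| * #|T| ^ #|T| * #|U| + #|T| ^ 2 * #|U| ^ #|T|)%N.
Proof.
set inj := [set v : {ffun T -> U} | injectiveb v &&
  all (fun p => [set v p.1; v p.2] \in edges G) es].
set noninj := [set v : {ffun T -> U} | ~~ injectiveb v].
apply: (@leq_trans ((#|inj| + #|noninj|) * #|U|)).
  rewrite leq_mul2r; apply/orP; right.
  apply: leq_trans (leq_card_setU _ _); apply: subset_leq_card.
  apply/subsetP=> v; rewrite inE => /andP[_ /allP v_hom].
  rewrite !inE; case: (injectiveb v) => //=; rewrite orbF.
  apply/allP=> p /v_hom; rewrite inE.
  exact: subsetP (packing_edges_sub K_copies) _.
rewrite mulnDl leq_add ?card_noninjective // leq_mul2r card_embeddings.
by rewrite orbT.
Qed.

(** All quantities are bounded by powers of [2]: the density [alpha] and the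
    share [a0] by [2 ^ - (3 b)], and the number of atoms by [2 ^ s]. *)
Lemma few_homs (b s Q : nat) (a0 alpha : R) (V : T -> {set U}) :
    (0 < #|T| <= b)%N -> (#|T| ^ 2 <= 2 ^ b)%N -> (size es <= b)%N ->
    (0 < #|copies H G|)%N -> ((2 ^ (3 * b))%:R)^-1 <= a0 ->
    ((2 ^ (3 * b))%:R)^-1 <= alpha ->
    (b * (b + (1 + 6 * b ^ 2 + s * b) + 2) + (1 + 6 * b ^ 2 + s * b) + 2 <= Q)%N ->
    (2 ^ Q * #|copies H G| <= #|U| ^ #|T|)%N ->
    (forall k, a0 * #|U|%:R / (2 ^ s)%:R <= #|V k|%:R) ->
  #|homs V es (fun=> arcs K)|%:R < alpha ^+ size es / 2 * #|choices V|%:R.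
Proof.
move=> h_le h2_le e_le C_gt0 a0_ge alpha_ge Q_ge n_ge V_large.
have := few_homs_arith h_le h2_le C_gt0 Q_ge n_ge (card_homs_arcs V).
set Z := (1 + _ + _)%N => few.
have {h_le} [h_gt0 h_le] := andP h_le.
pose q (k : nat) : R := ((2 ^ k)%:R)^-1.
have qD k l : q (k + l)%N = q k * q l by rewrite /q expnD natrM invfM.
have qM k l : q (k * l)%N = q k ^+ l by rewrite /q expnM natrX exprVn.
have q_gt0 k : 0 < q k by rewrite invr_gt0 ltr0n expn_gt0.
have choices_ge : (q (3 * b + s)%N * #|U|%:R) ^+ #|T| <= #|choices V|%:R.
  rewrite card_choices natr_prod -prodr_const; apply: ler_prod => k _.
  rewrite mulr_ge0 ?(ltW (q_gt0 _)) //=; apply: le_trans (V_large k).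
  rewrite qD mulrAC ler_wpM2r ?(ltW (q_gt0 s)) //.
  by rewrite ler_wpM2r.
have alpha_pow : q (3 * b * size es)%N <= alpha ^+ size es.
  by rewrite qM lerXn2r ?nnegrE ?(ltW (q_gt0 _)) ?(le_trans (ltW (q_gt0 _)) alpha_ge).
apply: (@lt_le_trans _ _ (q Z * #|U|%:R ^+ #|T|)).
  by rewrite /q ltr_pdivlMl ?ltr0n ?expn_gt0 // mulrC -natrX -natrM ltr_nat.
apply: (@le_trans _ _ (q (3 * b * size es)%N / 2 * (q (3 * b + s)%N * #|U|%:R) ^+ #|T|)).
  rewrite exprMn mulrA ler_wpM2r ?exprn_ge0 // -qM.
  have -> : 2^-1 = q 1%N by rewrite /q expn1.
  rewrite -!qD /q lef_pV2 ?posrE ?ltr0n ?expn_gt0 // ler_nat leq_exp2l // /Z.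
  rewrite -mulnn; nia.
apply: ler_pM => //.
- by rewrite mulr_ge0 ?(ltW (q_gt0 _)) // invr_ge0.
- by rewrite exprn_ge0 // mulr_ge0 ?(ltW (q_gt0 _)).
- by rewrite ler_wpM2r ?invr_ge0.
Qed.

End FewHoms.

Theorem theorem1 (R : realType) (T : finType) (H : sgraph T) (h : nat)
    (eps delta : R) :
  #|T| = h ->
  (exists e, e \in edges H) ->
  0 < eps < 1 ->
  0 < delta ->
  delta^-1 = (tow (removal_height h eps))%:R ->
  forall (U : finType) (G : sgraph U) (n : nat),
    #|U| = n ->
    #|copies H G|%:R <= delta * n%:R ^+ h ->
    exists F : {set {set U}},
      [/\ F \subset edges G,
          #|F|%:R <= eps * n%:R ^+ 2
        & free_of H (remove_edges G F)].
Proof.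
move=> <- {h} edgeH eps01 delta_gt0 deltaE U G _ <- le_copies.
have [K [K_copies K_disjoint K_free]] := exists_packing G edgeH.
have sFG := packing_edges_sub K_copies.
set F := \bigcup_(S in K) S.2 in K_free sFG.
exists F; split=> //; rewrite leNgt; apply/negP=> F_large.
have [e0 e0H] := edgeH; have [eps_gt0 eps_lt1] := andP eps01.
pose h := #|T|; pose e := size (oriented_edges H); pose n := #|U|.
have h_ge2 : (2 <= h)%N by rewrite -(edges_card2 e0H) max_card.
have e_gt0 : (0 < e)%N := size_oriented_gt0 e0H.
have e_le : (2 * e <= h ^ 2)%N := size_oriented H.
have F_gt0 : 0 < #|F|%:R :> R.
  by apply: le_lt_trans F_large; rewrite mulr_ge0 ?exprn_ge0 // ltW.
have n2_gt0 : 0 < n%:R ^+ 2 :> R.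
  rewrite exprn_gt0 // ltr0n lt0n; apply/eqP=> n0.
  move: F_gt0; rewrite ltr0n; have := double_card_edges sFG.
  by rewrite -/n n0 leqn0 muln_eq0 /= => /eqP->.
(* A graph has at most [n^2 / 2] edges, so that large [eps] is excluded. *)
have eps_lt : eps < 2^-1.
  rewrite -(ltr_pM2r n2_gt0); apply: lt_le_trans F_large _.
  rewrite ler_pdivlMl // -natrX -natrM ler_nat.
  exact: double_card_edges sFG.
have [|b [N [b_ge h4_le eps_ge height_ge N_gt]]] :=
  @height_parameters R h eps h_ge2; first by rewrite eps_gt0.
have [h_le h2_le e_le_b alpha_ge] :=
  parameter_bounds h_ge2 b_ge h4_le e_le e_gt0 eps_gt0 eps_ge.
have K_ge : #|F|%:R <= #|K|%:R * e%:R :> R.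
  by rewrite -natrM ler_nat; exact: card_packing K_copies.
have C_gt0 : (0 < #|copies H G|)%N.
  apply: leq_trans (subset_leq_card K_copies); rewrite -(ltr0n R).
  by have := lt_le_trans F_gt0 K_ge; rewrite pmulr_lgt0 // ltr0n.
have n_large : (tow (removal_height h eps) * #|copies H G| <= n ^ h)%N.
  by rewrite -(ler_nat R) natrM -deltaE ler_pdivrMl // natrX.
pose a0 := eps / (8 * e%:R); pose beta := a0 / 12; pose gamma := (beta / 2) ^+ e / 4.
have e_gt0' : 0 < e%:R :> R by rewrite ltr0n.
have a0_gt0 : 0 < a0 by rewrite divr_gt0 ?mulr_gt0.
have beta_gt0 : 0 < beta by rewrite divr_gt0.
have gamma_gt0 : 0 < gamma by apply: divr_gt0 => //; apply/exprn_gt0/divr_gt0.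
have a0_ge : ((2 ^ (3 * b))%:R)^-1 <= a0.
  by apply: le_trans alpha_ge _; rewrite -/a0; lra.
have alpha_gt0 : 0 < beta / 2 by apply: divr_gt0.
have alpha_le : (beta / 2)^-1 <= (2 ^ (3 * b))%:R.
  by rewrite invf_ple ?posrE ?ltr0n ?expn_gt0.
have gamma_ge : gamma^-1 <= (2 ^ (3 * b ^ 2 + 2))%:R.
  rewrite invf_div expnD natrM mulrC -[4]/((2 ^ 2)%:R) ler_wpM2r //.
  rewrite -exprVn; apply: (@le_trans _ _ ((2 ^ (3 * b))%:R ^+ e)).
    by apply: lerXn2r => //; rewrite nnegrE ?invr_ge0 ?(ltW alpha_gt0).
  rewrite -natrX -expnM ler_nat leq_exp2l // -mulnn -mulnA leq_mul2l /=.
  by rewrite leq_mul2l e_le_b orbT.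
pose g (p : U * U) : R := (p \in arcs K)%:R.
pose gain : R := (4 * e%:R)^-1 * (#|K|%:R - eps / (4 * e%:R) * n%:R ^+ 2).
have iterate r : (r <= N)%N -> exists SS : {set {set U}},
    (4 * #|SS| + tower_margin b <= tow (b + r))%N /\
    entropy (psignature (set0 : {set {set U}})) g + gain *+ r
      <= entropy (psignature SS) g.
  elim: r => [_|r IHr r_lt].
    by exists set0; rewrite cards0 addn0 tower_margin_le // mulr0n addr0.
  have [SS [SS_le SS_gain]] := IHr (ltnW r_lt).
  exists (refine (arcs K) beta gamma SS); split.
    rewrite addnS /=; apply: leq_trans (tower_step b_ge _) _; last first.
      by rewrite leq_exp2l //; apply: SS_le.
    exact: card_refine gamma_gt0 gamma_ge.
  rewrite mulrSr addrA; apply: le_trans (_ : _ <= entropy (psignature SS) g + gain) _.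
    by rewrite lerD2r.
  apply: (packing_gain K_copies K_disjoint e_gt0 eps01) => V V_large.
  apply: (few_homs (b := b) (s := #|SS|) (Q := tow (b + r).+1)
    K_copies _ h2_le e_le_b C_gt0 a0_ge alpha_ge _ _ V_large).
  - by rewrite h_le (ltnW h_ge2).
  - apply: leq_trans (tower_room _ b_ge) _ => /=.
    by rewrite leq_exp2l //; apply: SS_le.
  - apply: leq_trans n_large; rewrite leq_mul2r; apply/orP; right.
    rewrite -[(2 ^ _)%N]/(tow (b + r).+2); apply: leq_tow.
    by apply: leq_trans height_ge; rewrite addn2 !ltnS leq_add2l ltnW.
have [SS [_ SS_gain]] := iterate N (leqnn N).
have D_ge : #|F|%:R <= #|arcs K|%:R :> R by rewrite ler_nat (card_arcs_ge K_copies).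
have D_le : #|arcs K|%:R <= 2 * #|F|%:R :> R.
  by rewrite -natrM ler_nat (card_arcs_le K_copies).
have sum_g : \sum_p g p = #|arcs K|%:R.
  rewrite -sum1_card natr_sum [RHS]big_mkcond; apply: eq_bigr => p _.
  by rewrite /g; case: (p \in _).
have D_gt0 : 0 < #|arcs K|%:R :> R by apply: lt_le_trans D_ge.
have start : - (#|arcs K|%:R * ln eps^-1) <=
    entropy (psignature (set0 : {set {set U}})) g.
  rewrite entropy_trivial => [|p q]; last first.
    by congr (_, _); apply/setP=> S; rewrite !inE.
  rewrite sum_g -mulrN -lnV ?posrE ?invr_gt0 // invrK ler_pM2l //.
  rewrite card_prod natrM -expr2 ler_ln ?posrE ?divr_gt0 // ler_pdivlMr //.
  exact: le_trans (ltW F_large) D_ge.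
have stop : entropy (psignature SS) g <= 0.
  by apply: entropy_le0 => p; rewrite /g ler0n lern1 leq_b1.
(* Here [2 e <= h ^ 2] enters twice: once through the proportion of the edges
   that lie in pairs with a cover, once through the proportion [1 / (2 e)] of
   the cover. *)
have gain_ge : 3 / 4 * #|F|%:R <= h%:R ^+ 4 * gain.
  have gainE : gain = (16 * e%:R ^+ 2)^-1 *
      (4 * (#|K|%:R * e%:R) - eps * n%:R ^+ 2).
    by rewrite /gain; field; rewrite gt_eqF.
  have e4_le : 4 * e%:R ^+ 2 <= h%:R ^+ 4 :> R.
    have := leq_mul e_le e_le; rewrite -expnD -(ler_nat R) natrX !natrM; lra.
  have brace : 3 * #|F|%:R <= 4 * (#|K|%:R * e%:R) - eps * n%:R ^+ 2 by rewrite /n; lra.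
  have gain_ge : (16 * e%:R ^+ 2)^-1 * (3 * #|F|%:R) <= gain.
    by rewrite gainE ler_wpM2l // invr_ge0 mulr_ge0 // exprn_ge0.
  apply: (@le_trans _ _ (4 * e%:R ^+ 2 * ((16 * e%:R ^+ 2)^-1 * (3 * #|F|%:R)))).
    by rewrite le_eqVlt; apply/orP; left; apply/eqP; field; rewrite gt_eqF.
  by apply: ler_pM => //; rewrite ?mulr_ge0 ?invr_ge0 ?mulr_ge0 ?exprn_ge0.
have x_gt0 : 0 < ln eps^-1 by rewrite ln_gt0 // invf_gt1.
have h4_gt0 : 0 < h%:R ^+ 4 :> R by rewrite exprn_gt0 // ltr0n ltnW.
have total : gain * N%:R <= 2 * #|F|%:R * ln eps^-1.
  have : #|arcs K|%:R * ln eps^-1 <= 2 * #|F|%:R * ln eps^-1 by rewrite ler_pM2r.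
  by move: SS_gain; rewrite -mulr_natr; lra.
have gain_gt0 : 0 < gain.
  by rewrite -(pmulr_rgt0 _ h4_gt0); apply: lt_le_trans gain_ge;
    rewrite !mulr_gt0 ?invr_gt0.
have : gain * (3 * h%:R ^+ 4 * ln eps^-1) < gain * N%:R by rewrite ltr_pM2l.
have : 3 / 4 * #|F|%:R * ln eps^-1 <= h%:R ^+ 4 * gain * ln eps^-1 by rewrite ler_pM2r.
have : 0 < #|F|%:R * ln eps^-1 by rewrite mulr_gt0.
move: total; lra.
Qed.
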